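(* Let $G$ be a locally compact group. If $G\in[\mathrm{FC}]^-$, i.e. every conjugacy class $\{gtg^{-1} : g\in G\}$ ($t\in G$) is precompact in $G$, then $\operatorname{TLIM}(G)\subset\operatorname{TIM}(G)$.
   Context: $L_\infty(G)$ is the dual of $L_1(G)$ (left Haar measure). $\mathcal P_1(G) = \{f\in L_1(G) : f\ge 0, \|f\|_1 = 1\}$. For $T\in L_\infty(G)$ and $f,g\in L_1(G)$, define $fT, Tf\in L_\infty(G)$ by $\langle fT,g\rangle = \langle T, f*g\rangle$ and $\langle Tf,g\rangle = \langle T,g*f\rangle$. A mean is a positive unital linear functional on $L_\infty(G)$. A mean $m$ is topologically left invariant if $\langle m,fT\rangle = \langle m,T\rangle$ for all $f\in\mathcal P_1(G)$, $T\in L_\infty(G)$; topologically right invariant if $\langle m,Tf\rangle = \langle m,T\rangle$ for all such $f,T$; topologically two-sided invariant if both. $\operatorname{TLIM}(G)$ and $\operatorname{TIM}(G)$ denote the sets of topologically left invariant and topologically two-sided invariant means on $L_\infty(G)$. *)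

(* Defs.v *)
From HB Require Import structures.
From mathcomp Require Import all_boot all_order all_algebra.
From mathcomp Require Import all_classical all_reals all_analysis.
From mathcomp Require Import measurable_realfun complex ring lra.

Set Implicit Arguments.
Unset Strict Implicit.
Unset Printing Implicit Defensive.
Import Order.TTheory GRing.Theory Num.Theory.
Import numFieldNormedType.Exports.

Local Open Scope classical_set_scope.
Local Open Scope ring_scope.
Local Open Scope complex_scope.

(* The (irrelevant) distinguished point is there because measurableType
   requires one; no Hausdorff or local compactness assumption is built in. *)
HB.mixin Record isTopologicalGroup G & PointedTopological G & Group G := {
  mulg_continuous : continuous (fun x : G * G => (x.1 * x.2)%g) ;
  invg_continuous : continuous (fun x : G => (x^-1)%g)
}.

#[short(type="topologicalGroupType")]
HB.structure Definition TopologicalGroup :=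
  {G of PointedTopological G & Group G & isTopologicalGroup G}.

Definition borel (G : topologicalGroupType) := g_sigma_algebraType (@open G).

(* Left Haar measure: a nonzero left-invariant Radon measure on the Borel sets,
   with the convention that Radon measures are finite on compact sets, outer
   regular on Borel sets and inner regular on open sets. *)
Record left_haar_measure (R : realType) (G : topologicalGroupType)
    (mu : {measure set (borel G) -> \bar R}) : Prop := LeftHaarMeasure {
  haar_neq0 : mu [set: G] != 0%E ;
  haar_compact : forall K : set G, compact K -> (mu K < +oo)%E ;
  haar_left : forall (x : G) (A : set (borel G)), measurable A ->
    mu [set (x * y)%g | y in (A : set G)] = mu A ;
  haar_outer : forall A : set (borel G), measurable A ->
    mu A = ereal_inf [set mu U | U in [set U : set G | open U /\ A `<=` U]] ;
  haar_inner : forall U : set G, open U ->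
    mu U = ereal_sup [set mu K | K in [set K : set G | compact K /\ K `<=` U]]
}.

Definition FC_closure (G : topologicalGroupType) : Prop :=
  forall t : G, precompact [set (g * t * g^-1)%g | g in [set: G]].

Section L1.
Context (R : realType) (G : topologicalGroupType)
  (mu : {measure set (borel G) -> \bar R}).

Definition cintegrable (f : G -> R[i]) : Prop :=
  mu.-integrable setT (fun x : borel G => (complex.Re (f x))%:E) /\
  mu.-integrable setT (fun x : borel G => (complex.Im (f x))%:E).

Definition cintegral (f : G -> R[i]) : R[i] :=
  (\int[mu]_x complex.Re (f x)) +i* (\int[mu]_x complex.Im (f x)).

Definition L1_pred : {pred G -> R[i]} := fun f => `[< cintegrable f >].

Lemma L1_submod_closed : submod_closed L1_pred.
Proof.
split.
  apply/asboolP; split; rewrite (_ : (fun _ => _) = cst 0%E);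
    by [exact: integrable0 | apply/funext].
move=> a f g /asboolP[fr fi] /asboolP[gr gi]; apply/asboolP; case: a => a b.
split.
- rewrite (_ : (fun _ => _) = (fun x => a%:E * (complex.Re (f x))%:E)%E \+
    ((fun x => (- b)%:E * (complex.Im (f x))%:E)%E \+
     (fun x => (complex.Re (g x))%:E))%E)%E; last first.
    apply/funext => x /=; rewrite -!EFinM -!EFinD; congr _%:E.
    rewrite !fctE; case: (f x) => u v; case: (g x) => w z /=.
    by rewrite addrA mulNr.
  apply: integrableD => //; first exact: integrableZl.
  by apply: integrableD => //; exact: integrableZl.
- rewrite (_ : (fun _ => _) = (fun x => a%:E * (complex.Im (f x))%:E)%E \+
    ((fun x => b%:E * (complex.Re (f x))%:E)%E \+
     (fun x => (complex.Im (g x))%:E))%E)%E; last first.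
    apply/funext => x /=; rewrite -!EFinM -!EFinD; congr _%:E.
    by rewrite !fctE; case: (f x) => u v; case: (g x) => w z /=; rewrite addrA.
  apply: integrableD => //; first exact: integrableZl.
  by apply: integrableD => //; exact: integrableZl.
Qed.

HB.instance Definition _ :=
  GRing.isSubmodClosed.Build R[i] (G -> R[i]) L1_pred L1_submod_closed.

(* Elements are integrable functions rather than almost-everywhere classes:
   norm1 is a seminorm, and a functional bounded for norm1 automatically
   identifies functions equal almost everywhere, so that Linfty below is the
   dual of the usual Banach space. *)
Record L1 := MkL1 { L1_fun :> G -> R[i] ; _ : L1_fun \in L1_pred }.
HB.instance Definition _ := [isSub for L1_fun].
HB.instance Definition _ := [Choice of L1 by <:].
HB.instance Definition _ := [SubChoice_isSubLmodule of L1 by <:].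

Definition norm1 (f : L1) : R := \int[mu]_x complex.Re `|f x|.

Lemma cintegrableP (f : L1) : cintegrable f.
Proof. by case: f => f fP; exact/asboolP. Qed.

Lemma cintegral_scalar : scalar (cintegral : L1 -> R[i]).
Proof.
move=> [a b] f g; have [fr fi] := cintegrableP f.
have [gr gi] := cintegrableP g.
apply/eqP; rewrite eq_complex /=; apply/andP; split; apply/eqP.
- rewrite -RintegralZl// -[in X in _ - X]RintegralZl// -RintegralB//.
  + rewrite -RintegralD//.
    * apply: eq_Rintegral => x _.
      rewrite -[LHS]/(complex.Re ((a +i* b) * L1_fun f x + L1_fun g x)).
      by move: (L1_fun f x) (L1_fun g x) => [u v] [w z].
    * by rewrite (_ : _ \o _ = ((fun x => a%:E * (complex.Re (f x))%:E) \-
         (fun x => b%:E * (complex.Im (f x))%:E))%E)//;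
        apply: integrableB => //; exact: integrableZl.
  + exact: (integrableZl measurableT a fr).
  + exact: (integrableZl measurableT b fi).
- rewrite -RintegralZl// -[in X in _ + X + _]RintegralZl// -RintegralD//.
  + rewrite -RintegralD//.
    * apply: eq_Rintegral => x _.
      rewrite -[LHS]/(complex.Im ((a +i* b) * L1_fun f x + L1_fun g x)).
      by move: (L1_fun f x) (L1_fun g x) => [u v] [w z].
    * by rewrite (_ : _ \o _ = ((fun x => a%:E * (complex.Im (f x))%:E) \+
         (fun x => b%:E * (complex.Re (f x))%:E))%E)//;
        apply: integrableD => //; exact: integrableZl.
  + exact: (integrableZl measurableT a fi).
  + exact: (integrableZl measurableT b fr).
Qed.

Lemma integrable_normc (f : L1) :
  mu.-integrable setT (fun x : borel G => (complex.Re `|f x|)%:E).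
Proof.
have [fr fi] := cintegrableP f.
have mr : measurable_fun setT (fun x : borel G => complex.Re (f x)).
  by apply/measurable_EFinP; exact: measurable_int fr.
have mi : measurable_fun setT (fun x : borel G => complex.Im (f x)).
  by apply/measurable_EFinP; exact: measurable_int fi.
apply: (@le_integrable _ _ _ _ _ _ _
  ((fun x : borel G => `|(complex.Re (f x))%:E|) \+
   (fun x : borel G => `|(complex.Im (f x))%:E|))%E) => //.
- apply/measurable_EFinP.
  rewrite (_ : (fun _ => _) = fun x : borel G =>
    ((complex.Re (f x)) ^+ 2 + (complex.Im (f x)) ^+ 2) `^ 2^-1); last first.
    apply/funext => x; rewrite powR12_sqrt ?addr_ge0 ?sqr_ge0//.
    by case: (L1_fun f x).
  have m2 : measurable_fun setT (fun x : borel G =>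
      complex.Re (f x) ^+ 2 + complex.Im (f x) ^+ 2).
    by apply: measurable_funD; exact: measurable_funX.
  exact: (measurableT_comp (measurable_powR 2^-1) m2).
- move=> x _; rewrite [leLHS]/= [leRHS]/= lee_fin; case: (L1_fun f x) => u v /=.
  rewrite ger0_norm ?sqrtr_ge0// ger0_norm ?addr_ge0//.
  rewrite -(@ler_pXn2r _ 2) ?nnegrE ?sqrtr_ge0 ?addr_ge0//.
  rewrite sqr_sqrtr ?addr_ge0 ?sqr_ge0// sqrrD !real_normK ?num_real//.
  by rewrite lerD2r lerDl mulrn_wge0// mulr_ge0.
- by apply: integrableD => //; exact: integrable_abse.
Qed.

Lemma norm1_ge0 (f : L1) : 0 <= norm1 f.
Proof.
rewrite /norm1; apply: Rintegral_ge0 => x _.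
by case: (L1_fun f x) => u v /=; exact: sqrtr_ge0.
Qed.

Definition bounded_functional (T : L1 -> R[i]) : Prop :=
  scalar T /\ exists c : R, forall f, `|T f| <= (c * norm1 f)%:C.

Definition Linfty_pred : {pred L1 -> R[i]} :=
  fun T => `[< bounded_functional T >].

Lemma Linfty_submod_closed : submod_closed Linfty_pred.
Proof.
split.
  apply/asboolP; split.
    by move=> a f g; rewrite -[LHS]/0 -[RHS]/(a * 0 + 0) mulr0 addr0.
  by exists 0 => f; rewrite -[X in `|X|]/0 normr0 mul0r.
move=> a S T /asboolP[Sl [c Sc]] /asboolP[Tl [d Td]]; apply/asboolP; split.
  move=> b f g.
  rewrite -[LHS]/(a * S (b *: f + g) + T (b *: f + g)).
  rewrite -[RHS]/(b * (a * S f + T f) + (a * S g + T g)).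
  by rewrite Sl Tl; ring.
exists (complex.Re `|a| * c + d) => f.
have aE : `|a| = (complex.Re `|a|)%:C by case: a.
rewrite -[X in `|X|]/(a * S f + T f) mulrDl -mulrA rmorphD rmorphM/= -aE.
apply: le_trans (ler_normD _ _) _; apply: lerD => //.
by rewrite normrM ler_wpM2l.
Qed.

HB.instance Definition _ :=
  GRing.isSubmodClosed.Build R[i] (L1 -> R[i]) Linfty_pred Linfty_submod_closed.

Record Linfty := MkLinfty {
  Linfty_fun :> L1 -> R[i] ;
  _ : Linfty_fun \in Linfty_pred
}.
HB.instance Definition _ := [isSub for Linfty_fun].
HB.instance Definition _ := [Choice of Linfty by <:].
HB.instance Definition _ := [SubChoice_isSubLmodule of Linfty by <:].

Lemma one_Linfty_subproof : (cintegral : L1 -> R[i]) \in Linfty_pred.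
Proof.
apply/asboolP; split; first exact: cintegral_scalar.
exists 2 => f; have [fr fi] := cintegrableP f.
have nf := integrable_normc f.
rewrite /cintegral [X in X <= _]normc_def lecR /=.
set a := Rintegral _ _ _; set b := Rintegral _ _ _.
have ha : `|a| <= norm1 f.
  apply: le_trans (le_normr_Rintegral _ fr) _ => //.
  apply: le_Rintegral => //; first exact: integrable_norm.
  move=> x _; case: (L1_fun f x) => u v /=.
  by rewrite -sqrtr_sqr ler_wsqrtr// lerDl sqr_ge0.
have hb : `|b| <= norm1 f.
  apply: le_trans (le_normr_Rintegral _ fi) _ => //.
  apply: le_Rintegral => //; first exact: integrable_norm.
  move=> x _; case: (L1_fun f x) => u v /=.
  by rewrite -sqrtr_sqr ler_wsqrtr// lerDr sqr_ge0.
rewrite -(@ler_pXn2r _ 2) ?nnegrE ?sqrtr_ge0 ?mulr_ge0 ?norm1_ge0//.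
rewrite sqr_sqrtr ?addr_ge0 ?sqr_ge0// -[a ^+ 2]real_normK ?num_real//.
rewrite -[b ^+ 2]real_normK ?num_real//.
have : `|a| ^+ 2 <= norm1 f ^+ 2 by rewrite ler_pXn2r ?nnegrE ?norm1_ge0.
have : `|b| ^+ 2 <= norm1 f ^+ 2 by rewrite ler_pXn2r ?nnegrE ?norm1_ge0.
have := sqr_ge0 (norm1 f); rewrite exprMn.
by move: (`|a| ^+ 2) (`|b| ^+ 2) (norm1 f ^+ 2) => x y z; lra.
Qed.

(* The constant function 1, acting on L1 by integration. *)
Definition one_Linfty : Linfty := MkLinfty one_Linfty_subproof.

Definition nonneg_L1 (f : L1) : Prop := {ae mu, forall x : borel G, 0 <= f x}.

Definition P1 : set L1 := [set f | nonneg_L1 f /\ norm1 f = 1].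

(* When mu is a left Haar measure on a locally compact Hausdorff group, the
   integral defining the convolution converges for almost every x and yields an
   integrable function (Fubini), so the default value 0 of insubd is never used.
   The same holds below for lmodule_act f T, i.e. fT, and rmodule_act T f,
   i.e. Tf: they are bounded because norm1 (f * g) <= norm1 f * norm1 g. *)
Definition convolution (f g : L1) : L1 :=
  insubd 0 (fun x : G => cintegral (fun y : G => f y * g (y^-1 * x)%g)).

Definition lmodule_act (f : L1) (T : Linfty) : Linfty :=
  insubd 0 (fun g : L1 => T (convolution f g)).

Definition rmodule_act (T : Linfty) (f : L1) : Linfty :=
  insubd 0 (fun g : L1 => T (convolution g f)).

Definition nonneg_Linfty (T : Linfty) : Prop :=
  forall f : L1, nonneg_L1 f -> 0 <= T f.

Definition is_mean (m : {scalar Linfty}) : Prop :=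
  (forall T, nonneg_Linfty T -> 0 <= m T) /\ m one_Linfty = 1.

Definition top_left_invariant (m : {scalar Linfty}) : Prop :=
  forall f T, P1 f -> m (lmodule_act f T) = m T.

Definition top_right_invariant (m : {scalar Linfty}) : Prop :=
  forall f T, P1 f -> m (rmodule_act T f) = m T.

Definition TLIM : set {scalar Linfty} :=
  [set m | is_mean m /\ top_left_invariant m].

Definition TIM : set {scalar Linfty} :=
  [set m | [/\ is_mean m, top_left_invariant m & top_right_invariant m]].

End L1.

Arguments TLIM {R G} mu.
Arguments TIM {R G} mu.

(* Main.v *)
Require Import Defs.
From HB Require Import structures.
From mathcomp Require Import all_boot all_order all_algebra.
From mathcomp Require Import all_classical all_reals all_analysis.
From mathcomp Require Import measurable_realfun complex ring lra.

Set Implicit Arguments.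
Unset Strict Implicit.
Unset Printing Implicit Defensive.
Import Order.TTheory GRing.Theory Num.Theory.
Import numFieldNormedType.Exports.

Local Open Scope classical_set_scope.
Local Open Scope ring_scope.
Local Open Scope complex_scope.

(* Write [(u * v) z] for the integral of [u t * v (t^-1 z)] over [t], let [k] be
   a continuous compactly supported function and let [f >= 0] be bounded with
   compact support.  For [g >= 0], Fubini and left invariance give

     (k * g * f) z = \int f(x^-1) (\int k(z x z^-1 s) g(s^-1 z) ds) dx,

   a formula that involves no modular function.  In a group of class [FC]^- the
   conjugates [z x z^-1], for [x^-1] in the support of [f], stay in one compact
   set [C] (a Baire category argument).  Cutting [C] into finitely many Borel
   pieces [D_j] close to points [c_j] and using that [k] is uniformly
   continuous, the inner kernel is within [e] of the sum over [j] of
   [1_{D_j}(z x z^-1) k(c_j s)], so that for a positive functional [T] the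
   functional [k (T f)] is approximately the sum of the [h_j (q_j T)], with
   [h_j s = k (c_j s)] and [q_j z = \int f(x^-1) 1_{D_j}(z x z^-1) dx].  As the
   [q_j] add up to the constant [I = \int f(x^-1) dx], a topologically left
   invariant mean [m] satisfies [m (T f) >= I * m T].  Taking [T = 1], for [f]
   and for [x |-> f(x^-1)], gives [I = \int f]; approximating a density from
   below by such [f] gives [m (T f) >= m T] for every [f] in [P1], and applying
   this to [c 1 - T] gives equality.  Bounded functionals are linear
   combinations of positive ones. *)

(** Left invariance controls an action on the other side than the one in [T f]. Prepending [k] is
    free, because [m (k S) = \int k * m S], and it lets the right translation inside [T f] be traded
    for a left translation of [k]. The price is that the translating element becomes a conjugate
    depending on the point [z]. A mean is only finitely additive, so it cannot be taken under the
    integral over these conjugates. The partition of [C] replaces that integral by a finite sum, in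
    which all dependence on [z] sits in the multipliers [q_j] while the left translates [h_j] are
    fixed functions of mass [\int k]. Hence each term contributes [\int k * m (q_j T)], and the
    [q_j T] add up to [I T] exactly, however the weights vary with [z]. Compactness of [C] is used
    twice: for the finite partition, and for a single compact set [S] carrying every translate of
    [k] by an element of [C]. The error is then [e * I * mu S * m T], with [S] chosen before [e] and
    before the partition. One-sided estimates suffice, since the reverse inequalities come from
    replacing [f] by [x |-> f (x^-1)] and [T] by [c 1 - T]. *)

Local Notation borelT T := (g_sigma_algebraType (@open T)).

(** * Conjugates of compact sets *)

(** If [P K] failed, the sets whose complement in [K] satisfies [P] would form a proper filter, and
    a cluster point of it in [K] would contradict the local hypothesis there. This serves below in
    place of extracting finite subcovers. *)
Lemma compact_ind (T : topologicalType) (K : set T) (P : set T -> Prop) :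
  compact K -> P set0 -> (forall A B, P A -> P B -> P (A `|` B)) ->
  (forall A B, A `<=` B -> P B -> P A) ->
  (forall x, K x -> exists2 U, nbhs x U & P U) -> P K.
Proof.
move=> cK P0 PU PS Ploc; apply: contrapT => nPK.
pose F := [set U : set T | P (K `\` U)].
have FF : ProperFilter F.
  split; first by rewrite /F /= setD0.
  split.
  - by rewrite /F /= setDT.
  - by move=> A B FA FB; rewrite /F /= setDIr; exact: PU.
  - by move=> A B AB; apply: PS; exact: setDS.
have FK : F K by rewrite /F /= setDv.
have [p [Kp clp]] := cK F FF FK.
have [U Up PUU] := Ploc p Kp.
have [] := clp (~` U) U _ Up; last by move=> x [].
by apply: PS PUU; rewrite setDE setCK; exact: subIsetr.
Qed.

Section group_topology.
Context {G : topologicalGroupType}.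
Implicit Types (x y g : G) (A B K : set G).

Lemma continuousMg (T : topologicalType) (f h : T -> G) :
  continuous f -> continuous h -> continuous (fun t => (f t * h t)%g).
Proof.
move=> cf ch t.
apply: (@continuous_comp _ _ _ (fun t => (f t, h t)) (fun z => (z.1 * z.2)%g)).
  by apply: cvg_pair; [exact: cf|exact: ch].
exact: mulg_continuous.
Qed.

Lemma continuousVg (T : topologicalType) (f : T -> G) :
  continuous f -> continuous (fun t => (f t)^-1%g).
Proof.
move=> cf t; apply: (@continuous_comp _ _ _ f (fun z => z^-1%g)).
  exact: cf.
exact: invg_continuous.
Qed.

Lemma continuous_mulgl x : continuous (fun y => (x * y)%g).
Proof. by apply: continuousMg => // y; [exact: cst_continuous|exact: cvg_id]. Qed.

Lemma continuous_mulgr x : continuous (fun y => (y * x)%g).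
Proof. by apply: continuousMg => // y; [exact: cvg_id|exact: cst_continuous]. Qed.

Lemma continuous_conjg x : continuous (fun y => (x * y * x^-1)%g).
Proof.
apply: continuousMg; first exact: continuous_mulgl.
by move=> y; exact: cst_continuous.
Qed.

Lemma compact_image (T U : topologicalType) (f : T -> U) (K : set T) :
  continuous f -> compact K -> compact (f @` K).
Proof.
by move=> cf; apply: continuous_compact; apply: continuous_subspaceT.
Qed.

Lemma compact_mulg A B : compact A -> compact B ->
  compact [set (a * b)%g | a in A & b in B].
Proof.
move=> cA cB; rewrite (_ : [set _ | _ in _ & _ in _] =
    (fun z : G * G => (z.1 * z.2)%g) @` (A `*` B)).
  apply: compact_image; first exact: mulg_continuous.
  exact: compact_setX.
apply/seteqP; split => [_ [a Aa [b Bb <-]]|_ [[a b] [/= Aa Bb] <-]].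
  by exists (a, b).
by exists a => //; exists b.
Qed.

Lemma nbhs_mulgl x y A : nbhs (x * y)%g A -> nbhs y [set z | A (x * z)%g].
Proof. by move=> h; exact: (continuous_mulgl h). Qed.

Lemma open_mulgl x A : open A -> open [set y | A (x * y)%g].
Proof.
move=> oA; apply: (open_comp (f := fun y => (x * y)%g)) => // y _.
exact: continuous_mulgl.
Qed.

Lemma nbhs1_div A : nbhs (1%g : G) A -> exists2 W : set G,
  nbhs (1%g : G) W & forall x y, W x -> W y -> A (x^-1 * y)%g.
Proof.
move=> hA.
have c : continuous (fun z : G * G => (z.1^-1 * z.2)%g).
  apply: continuousMg; last by move=> z; exact: cvg_snd.
  by apply: continuousVg => z; exact: cvg_fst.
have := c (1%g, 1%g) A; rewrite /= invg1 mul1g => /(_ hA) [[U V]] /= [U1 V1] UVA.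
exists (U `&` V); first exact: filterI.
by move=> x y [Ux _] [_ Vy]; exact: (UVA (x, y)).
Qed.

Hypotheses (hG : hausdorff_space G) (lcG : locally_compact [set: G]).

Lemma compact_nbhs x A : nbhs x A -> exists K, [/\ compact K, nbhs x K & K `<=` A].
Proof.
move=> hA; have [V hV [cV clV]] := lcG (I : [set: G] x).
have nV : nbhs x V by move: hV; rewrite /within/=; apply: filterS => y; exact.
have [B nB BA] := compact_regular hG cV nV hA.
exists (closure B `&` V); split.
- rewrite setIC; apply: (subclosed_compact _ cV) => //.
  by apply: closedI => //; exact: closed_closure.
- by apply: filterI => //; apply: filterS nB; exact: subset_closure.
- by apply: subset_trans BA; exact: subIsetl.
Qed.

Lemma nbhs1_compact : exists2 K, compact K & nbhs (1%g : G) K.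
Proof. by have [K [cK nK _]] := compact_nbhs (@filterT _ _ (nbhs_filter (1%g : G))); exists K. Qed.

Hypothesis fcG : FC_closure G.

Lemma conjg_bounded1 x : exists2 C, compact C & forall g, C (g * x * g^-1)%g.
Proof.
by have [C hC [cC _]] := fcG x; exists C => // g; apply: hC; exists g.
Qed.

(* Gliding hump: otherwise nested compact sets [L n] and elements [g n] are
   built with [g n L_n (g n)^-1] disjoint from [B n V], where [B n] is the
   union of the previous conjugates; a point of all the [L n] then has a
   conjugacy class containing an infinite [V]-separated sequence. *)
Lemma conjg_bounded_open : exists O : set G, [/\ open O, O !=set0 &
  exists2 C, compact C & forall g x, O x -> C (g * x * g^-1)%g].
Proof.
apply: contrapT => H.
have {}H (O C : set G) : open O -> O !=set0 -> compact C ->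
    exists g x, O x /\ ~ C (g * x * g^-1)%g.
  move=> oO O0 cC; apply: contrapT => H'; apply: H; exists O; split => //.
  exists C => // g x Ox; apply: contrapT => nC; apply: H'; by exists g, x.
have [V cV nV] := nbhs1_compact.
(* A state [((L, B), g)] holds the current compact set [L], the union [B] of the conjugates built so
   far, and the element [g] that produced the last of them. *)
pose good (s : set G * set G * G) :=
  [/\ compact s.1.1, s.1.1° !=set0 & compact s.1.2].
pose cj g x := (g * x * g^-1)%g.
pose next (s s' : set G * set G * G) := [/\ good s', s'.1.1 `<=` s.1.1,
  s'.1.2 = s.1.2 `|` cj s'.2 @` s'.1.1 &
  forall b v, s.1.2 b -> V v -> ~ (cj s'.2 @` s'.1.1) (b * v)%g].
have step s : exists s', good s -> next s s'.
  have [gs|] := pselect (good s); last by move=> ns; exists s => /ns.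
  case: gs => cL L0 cB.
  have cBV := compact_mulg cB cV.
  have [g [x [Lx nx]]] := H _ _ (open_interior _) L0 cBV.
  have nb : nbhs x (s.1.1° `&` cj g @^-1` (~` [set (a * b)%g | a in s.1.2 & b in V])).
    apply: filterI; first by apply: open_nbhs_nbhs; split => //; exact: open_interior.
    apply: (continuous_conjg (x:=g)).
    apply: open_nbhs_nbhs; split => //.
    by apply: closed_openC; exact: compact_closed cBV.
  have [L [cL' nL LS]] := compact_nbhs nb.
  exists (L, s.1.2 `|` cj g @` L, g) => _; split => //=.
  - split => //=; first by exists x.
    by apply: compactU => //; apply: compact_image cL'; exact: continuous_conjg.
  - by move=> y /LS[/interior_subset].
  - move=> b v Bb Vv [y /LS[_ /=]] hy e; apply: hy; rewrite e.
    by exists b => //; exists v.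
have [f fP] := choice step.
have [K0 cK0 nK0] := nbhs1_compact.
pose s n := iter n f (K0, set0, 1%g).
have gs n : good (s n).
  elim: n => [|n IH]; first by split => //=; [exists 1%g|exact: compact0].
  by have [] := fP _ IH.
have ns n : next (s n) (s n.+1) by apply: fP.
pose L n := (s n).1.1; pose B n := (s n).1.2; pose g n := (s n.+1).2.
have Ldec m n : (m <= n)%N -> L n `<=` L m.
  move=> /subnK <-; elim: (n - m)%N => // k IH.
  by apply: subset_trans IH; rewrite addSn; have [] := ns (k + m)%N.
have Binc m n : (m <= n)%N -> B m `<=` B n.
  move=> /subnK <-; elim: (n - m)%N => // k IH.
  apply: subset_trans IH _; rewrite addSn /B.
  by have [_ _ -> _] := ns (k + m)%N; exact: subsetUl.
have [x Lx] : exists x, forall n, L n x.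
  have /choice[u uL] : forall n, exists x, L n x.
    by move=> n; have [_ [x /interior_subset]] := gs n; exists x.
  have [cL0 _ _] := gs 0%N.
  have [|p [_ clp]] := cL0 (u @ \oo) _.
    by exists 0%N => // n _ /=; exact: (Ldec 0%N n).
  exists p => n.
  have [cLn _ _] := gs n.
  have := compact_closed hG cLn; rewrite closure_id => e; rewrite /L e.
  move=> W nW; apply: clp nW.
  by exists n => // m /= nm; exact: (Ldec n m).
have [C cC CP] := conjg_bounded1 x.
pose y n := cj (g n) x.
have [|p [_ clp]] := cC (y @ \oo) _; first by exists 0%N => // n _; exact: CP.
(* Two terms of [y] near the cluster point [p] lie in the same translate [p W], so [(y m)^-1 * y n]
   lies in [V]; for [m < n] this contradicts the separation of the later conjugate from [B n V]. *)
have [W nW WV] := nbhs1_div nV.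
have nW' : nbhs p [set z | W (p^-1 * z)%g].
  by apply: nbhs_mulgl; rewrite mulVg.
have [|_ [[m _ <-] /= Wm]] := clp (range y) _ _ nW'.
  by exists 0%N => // n _ /=; exists n.
have [|_ [[n /= mn <-] /= Wn]] := clp (y @` [set n | (m < n)%N]) _ _ nW'.
  by exists m.+1 => // n /= mn; exists n.
have [_ _ _] := ns n.
move=> /(_ (y m) ((y m)^-1 * y n))%g; rewrite mulVKg; apply.
- apply: (Binc _ _ mn); rewrite /B; have [_ _ -> _] := ns m; right.
  by exists x => //; exact: (Lx m.+1).
- by have := WV _ _ Wm Wn; rewrite invgM invgK mulgA mulgK.
- by exists x => //; exact: (Lx n.+1).
Qed.

(** Near [k], an element is [k w^-1] times an element of the good open set [U]. The conjugates of
    the first factor stay in a compact set by hypothesis, those of the second by the choice of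
    [U]. *)
Lemma conjg_bounded K : compact K ->
  exists2 C, compact C & forall g x, K x -> C (g * x * g^-1)%g.
Proof.
move=> cK; have [U [oU [w Uw] [C cC CP]]] := conjg_bounded_open.
apply: (compact_ind (P := fun A => exists2 C, compact C &
  forall g x, A x -> C (g * x * g^-1)%g)) cK _ _ _ _.
- by exists set0 => //; exact: compact0.
- move=> A B [CA cCA hA] [CB cCB hB]; exists (CA `|` CB); first exact: compactU.
  by move=> g x [Ax|Bx]; [left; exact: hA|right; exact: hB].
- by move=> A B AB [D cD hD]; exists D => // g x /AB; exact: hD.
- move=> k _.
  have [D cD hD] := conjg_bounded1 (k * w^-1)%g.
  exists [set z | U (w * k^-1 * z)%g].
    by apply: nbhs_mulgl; rewrite -mulgA mulVg mulg1; exact: open_nbhs_nbhs.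
  exists [set (a * b)%g | a in D & b in C]; first exact: compact_mulg.
  move=> g x Ux; exists (g * (k * w^-1) * g^-1)%g; first exact: hD.
  exists (g * (w * k^-1 * x) * g^-1)%g; first exact: CP.
  by rewrite !mulgA mulgVK mulgVK mulgK.
Qed.

End group_topology.

(** * Tonelli's theorem for Borel functions on a product *)

HB.instance Definition _ (X Y : ptopologicalType) := Pointed.on (X * Y)%type.

Lemma open_borel (T : ptopologicalType) (U : set T) :
  open U -> measurable (U : set (borelT T)).
Proof. by move=> oU; exact: sub_sigma_algebra. Qed.

Lemma closed_borel (T : ptopologicalType) (A : set T) :
  closed A -> measurable (A : set (borelT T)).
Proof.
move=> cA; rewrite -(setCK A); apply: measurableC.
by apply: open_borel; exact: closed_openC.
Qed.

Lemma compact_borel (T : ptopologicalType) (A : set T) : hausdorff_space T ->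
  compact A -> measurable (A : set (borelT T)).
Proof. by move=> hT cA; apply: closed_borel; exact: compact_closed. Qed.

Lemma continuous_borel (S T : ptopologicalType) (f : S -> T) :
  continuous f -> measurable_fun [set: borelT S] (f : borelT S -> borelT T).
Proof.
move=> cf; apply: (measurability _ (erefl : @measurable _ (borelT T) = <<s @open T >>)) => _ [U oU <-].
rewrite setTI; apply: open_borel; apply: open_comp => // x _; exact: cf.
Qed.

(* The Borel sets of a product may be more than the product of the Borel
   sigma-algebras, so Fubini's theorem for product measures does not apply to
   Borel functions on [X * Y]; regularity on open sets makes up for it. *)
Definition inner_open (R : realType) (T : ptopologicalType)
    (mu : set (borelT T) -> \bar R) :=
  forall (U : set T) a, open U -> (a < mu U)%E ->
    exists K : set T, [/\ compact K, K `<=` U & (a < mu K)%E].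

(** * Slices of a Borel set, and the kernel they define *)

Section slice_kernel.
Context {R : realType} (X Y Z : ptopologicalType) (hY : hausdorff_space Y).
Variables (phi : X * Y -> Z) (nu : {finite_measure set (borelT Y) -> \bar R}).
Hypotheses (cphi : continuous phi) (inu : inner_open nu).
Local Open Scope ereal_scope.

Let slice x : borelT Y -> borelT Z := fun y => phi (x, y).

Let mslice x : measurable_fun [set: borelT Y] (slice x).
Proof.
apply: continuous_borel => y; apply: continuous_comp; last exact: cphi.
by apply: cvg_pair; [exact: cvg_cst|exact: cvg_id].
Qed.

Let mslice_pre x (E : set (borelT Z)) : measurable E ->
  measurable (slice x @^-1` E).
Proof. by move=> mE; rewrite -[X in measurable X]setTI; exact: mslice. Qed.

(** Lower semicontinuity of the slice measure: a compact part of the slice with measure above [a]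
    stays inside all nearby slices, by the tube argument. *)
Lemma open_slice_lsc (E : set Z) (a : \bar R) : open E ->
  open [set x | a < nu [set y | E (phi (x, y))]].
Proof.
move=> oE; rewrite openE => x /= ax.
have oEx : open [set y | E (phi (x, y))].
  apply: (open_comp (f := fun y => phi (x, y))) => // y _.
  apply: continuous_comp; last exact: cphi.
  by apply: cvg_pair; [exact: cvg_cst|exact: cvg_id].
have [K [cK KE aK]] := inu oEx ax.
have nK : \forall x' \near x, K `<=` [set y | E (phi (x', y))].
  move: cK; rewrite compact_near_coveringP => /(_ _ _ (fun x' y => E (phi (x', y)))).
  apply => y /KE/= Exy.
  have : nbhs (x, y) (phi @^-1` E) by apply: cphi; exact: open_nbhs_nbhs.
  move=> [[A B] /= [nA nB] AB]; exists (B, A) => //= -[y' x'] /= [By' Ax'].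
  exact: (AB (x', y')).
apply: filterS nK => x' Kx'; apply: (lt_le_trans aK).
apply: le_measure; rewrite ?inE//; first exact: compact_borel.
by apply: mslice_pre; exact: open_borel.
Qed.

(** Semicontinuity settles the open sets, which are stable under intersection and generate the Borel
    sets; Dynkin induction does the rest, with finiteness of [nu] used for complements. *)
Lemma measurable_slice (E : set (borelT Z)) : measurable E ->
  measurable_fun [set: borelT X] (fun x => nu (slice x @^-1` E)).
Proof.
move=> mE; apply: (@dynkin_induction _ (borelT Z) (@open Z) (fun E =>
  measurable_fun [set: borelT X] (fun x => nu (slice x @^-1` E))) erefl) => //.
- by move=> A B; exact: openI.
- exact: (measurable_cst (nu setT)).
- move=> U oU /=.
  apply: (measurability _ (ErealGenOInfty.measurableE R)) => _ [_ [a ->] <-].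
  rewrite setTI preimage_itvoy; apply: open_borel.
  exact: (open_slice_lsc a%:E oU).
- move=> S mS PS.
  rewrite (_ : (fun _ => _) = (fun x => nu setT - nu (slice x @^-1` S))).
    by apply: emeasurable_funB.
  apply/funext => x; rewrite preimage_setC -[X in nu X = _]setTD.
  rewrite measureD ?setTI//; first exact: mslice_pre.
  by rewrite ltey_eq fin_num_measure.
- move=> F mF tF PF.
  rewrite (_ : (fun _ => _) = (fun x => \sum_(k <oo) nu (slice x @^-1` F k))).
    by apply: ge0_emeasurable_sum.
  apply/funext => x; rewrite preimage_bigcup measure_bigcup//.
  + by apply: eq_eseriesl => i; rewrite in_setT.
  + by move=> i _; exact: mslice_pre.
  + by move=> i j _ _ [y [Fi Fj]]; apply: tF => //; exists (slice x y).
Qed.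

(* The [unit] factor is there because [kcomp] composes kernels from [T0] to [X]
   and from [T0 * X] to [Z]. *)
Definition slice_kernel (t : unit * borelT X) : set (borelT Z) -> \bar R :=
  pushforward nu (slice t.2).

Let slice_kernel0 t : slice_kernel t set0 = 0.
Proof. by rewrite /slice_kernel /pushforward preimage_set0 measure0. Qed.

Let slice_kernel_ge0 t A : 0 <= slice_kernel t A.
Proof. exact: measure_ge0. Qed.

Let slice_kernel_sigma_additive t : semi_sigma_additive (slice_kernel t).
Proof.
move=> F mF tF mUF; rewrite /slice_kernel /pushforward preimage_bigcup.
apply: measure_semi_sigma_additive.
- by move=> n; exact: mslice_pre.
- by move=> i j _ _ [y [Fi Fj]]; apply: tF => //; exists (slice t.2 y).
- by rewrite -preimage_bigcup; exact: mslice_pre.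
Qed.

HB.instance Definition _ t := isMeasure.Build _ _ R (slice_kernel t)
  (slice_kernel0 t) (slice_kernel_ge0 t) (@slice_kernel_sigma_additive t).

Let slice_kernel_measure : unit * borelT X -> {measure set (borelT Z) -> \bar R} :=
  slice_kernel.

Let measurable_slice_kernel U : measurable U ->
  measurable_fun [set: unit * borelT X] (slice_kernel_measure ^~ U).
Proof.
move=> mU; apply: (measurableT_comp (measurable_slice mU)).
exact: measurable_snd.
Qed.

HB.instance Definition _ := isKernel.Build _ _ _ _ _ slice_kernel_measure
  measurable_slice_kernel.

Let slice_kernel_uub : measure_fam_uub slice_kernel_measure.
Proof.
exists (fine (nu setT) + 1)%R => x; rewrite /slice_kernel_measure/=.
rewrite /slice_kernel /pushforward preimage_setT EFinD fineK ?fin_num_measure//.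
by rewrite lteDl ?fin_num_measure// lte_fin.
Qed.

HB.instance Definition _ := Kernel_isFinite.Build _ _ _ _ R slice_kernel_measure
  slice_kernel_uub.

Definition slice_fker : R.-fker (unit * borelT X)%type ~> borelT Z :=
  slice_kernel_measure.

End slice_kernel.

(** Upper half of a discrete layer-cake formula of step [d]; the extra [1] pays for the part of [r]
    above the last level passed. *)
Lemma le_layers (R : realType) (d r : R) (N : nat) : 0 <= d ->
  r <= N.+1%:R * d -> r <= d * (1 + \sum_(j < N) (j.+1%:R * d < r)%R%:R).
Proof.
move=> d0; elim: N => [|N IH] rN; first by rewrite big_ord0 addr0 mulrC.
rewrite big_ord_recr /=; case: ltP => [rlt|rge]; last by rewrite addr0; exact: IH.
rewrite (eq_bigr (fun=> 1)) => [|j _].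
  rewrite sumr_const card_ord (le_trans rN)// mulrC ler_wpM2l//.
  by rewrite -natr1 -natr1 addrA [1 + _]addrC.
suff -> : j.+1%:R * d < r by [].
by apply: le_lt_trans rlt; rewrite ler_wpM2r// ler_nat ltnS ltnW.
Qed.

(** Lower half, for any selection [b] of levels known to be reached: the level sets will be
    available only through compact subsets. *)
Lemma layers_le (R : realType) (d r : R) (b : nat -> bool) (N : nat) :
  0 <= d -> 0 <= r -> (forall j, (j < N)%N -> b j -> j.+1%:R * d <= r) ->
  d * \sum_(j < N) (b j)%:R <= r.
Proof.
move=> d0 r0; elim: N => [|N IH] br; first by rewrite big_ord0 mulr0.
case: (boolP (b N)) => [bN|/negbTE bN]; last first.
  by rewrite big_ord_recr /= bN addr0; apply: IH => j jN; apply: br; exact: ltnW.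
apply: le_trans (br N _ bN) => //; rewrite mulrC ler_wpM2r//.
apply: le_trans (_ : \sum_(j < N.+1) 1 <= _).
  by apply: ler_sum => j _; rewrite lern1 leq_b1.
by rewrite sumr_const card_ord.
Qed.

(** * One inequality of Tonelli's theorem for open sets *)

Section tonelli_open.
Context {R : realType} (X Y : ptopologicalType).
Hypotheses (hX : hausdorff_space X) (hY : hausdorff_space Y).
Variables (mu : {finite_measure set (borelT X) -> \bar R}).
Variables (nu : {finite_measure set (borelT Y) -> \bar R}).
Hypotheses (imu : inner_open mu) (inu : inner_open nu).
Local Open Scope ereal_scope.

Let sliceX (E : set (X * Y)) x : set (borelT Y) := [set y | E (x, y)].
Let sliceY (E : set (X * Y)) y : set (borelT X) := [set x | E (x, y)].

Let cid : continuous (fun z : X * Y => z).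
Proof. by move=> z; exact: cvg_id. Qed.

Let cswap : continuous (fun z : Y * X => (z.2, z.1)).
Proof. by move=> z; apply: cvg_pair; [exact: cvg_snd|exact: cvg_fst]. Qed.

(** The set [S] is a finite union of rectangles with one open and one compact side. It therefore
    belongs to the product sigma-algebra, where the classical theorem is available. *)
Lemma compact_layer (E : set (X * Y)) (K : set X) (a : R) : open E ->
  (0 <= a)%R -> compact K -> (forall x, K x -> a%:E < nu (sliceX E x)) ->
  exists S : set (borelT X * borelT Y), [/\ measurable S, S `<=` E &
    forall x, K x -> a%:E < nu (sliceX S x)].
Proof.
move=> oE a0 cK aK.
apply: (compact_ind (P := fun A => exists S : set (borelT X * borelT Y),
  [/\ measurable S, S `<=` E &
    forall x, A x -> a%:E < nu (sliceX S x)]) cK).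
- by exists set0; split; [exact: measurable0|exact: sub0set|move=> x []].
- move=> A B [S [mS SE hS]] [T [mT TE hT]]; exists (S `|` T); split.
  + exact: measurableU.
  + by move=> z [/SE|/TE].
  + move=> x ABx.
    have mSx : measurable (sliceX S x) by have := measurable_xsection (x : borelT X) mS; rewrite xsectionE.
    have mTx : measurable (sliceX T x) by have := measurable_xsection (x : borelT X) mT; rewrite xsectionE.
    have mSTx : measurable (sliceX (S `|` T) x) by exact: (measurableU _ _ mSx mTx).
    case: ABx => [/hS|/hT] /lt_le_trans; apply; apply: le_measure; rewrite ?inE//.
      by move=> y Sy; left.
    by move=> y Ty; right.
- by move=> A B AB [S [mS SE hS]]; exists S; split => // x /AB/hS.
- move=> x /aK ax.
  have oEx : open (sliceX E x).
    apply: (open_comp (f := fun y : Y => (x, y))) => // y _.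
    by apply: cvg_pair; [exact: cvg_cst|exact: cvg_id].
  have [L [cL LE aL]] := inu oEx ax.
  have : \forall x' \near x, L `<=` sliceX E x'.
    move: cL; rewrite compact_near_coveringP => /(_ _ _ (fun x' y => E (x', y))).
    apply => y /LE/= Exy.
    have : nbhs ((x, y) : X * Y) E by exact: (open_nbhs_nbhs (conj oE Exy)).
    move=> [[A B] /= [nA nB] AB].
    exists (B, A) => //= -[y' x'] /= [By' Ax'].
    exact: (AB (x', y')).
  rewrite -nbhs_nearE {1}nbhsE => -[U [oU Ux] UL].
  exists U; first exact: open_nbhs_nbhs.
  exists (U `*` L); split.
  + by apply: measurableX; [exact: open_borel|exact: compact_borel].
  + by move=> [x' y'] /= [/UL]; exact.
  + by move=> x' Ux'; rewrite (_ : sliceX _ _ = L)//; apply/seteqP; split => [y []|].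
Qed.

(** The level sets [U j] of the slice measure are open, so compact sets [K j] nearly exhaust them,
    and the layers over the [K j] are realised by a product-measurable [T] inside [E], to which the
    classical theorem applies. As [T] is merely contained in [E], only an inequality results;
    exchanging the factors gives the other one. *)
Lemma tonelli_open_le (E : set (X * Y)) : open E ->
  \int[mu]_x nu (sliceX E x) <= \int[nu]_y mu (sliceY E y).
Proof.
move=> oE.
have mEx : measurable_fun [set: borelT X] (fun x => nu (sliceX E x)).
  exact: (measurable_slice hY cid inu (open_borel oE)).
have mEy : measurable_fun [set: borelT Y] (fun y => mu (sliceY E y)).
  exact: (measurable_slice hX cswap imu (open_borel oE)).
have fnu (A : set (borelT Y)) : measurable A -> nu A \is a fin_num.
  by move=> mA; exact: fin_num_measure.
have fmu (A : set (borelT X)) : measurable A -> mu A \is a fin_num.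
  by move=> mA; exact: fin_num_measure.
have mX (S : set (borelT X * borelT Y)) x : measurable S -> measurable (sliceX S x).
  by move=> /(measurable_xsection (x : borelT X)); rewrite xsectionE.
have mY (S : set (borelT X * borelT Y)) y : measurable S -> measurable (sliceY S y).
  by move=> /(measurable_ysection (y : borelT Y)); rewrite ysectionE.
have oEX x : open (sliceX E x).
  apply: (open_comp (f := fun y : Y => (x, y))) => // y _.
  by apply: cvg_pair; [exact: cvg_cst|exact: cvg_id].
have oEY y : open (sliceY E y).
  apply: (open_comp (f := fun x : X => (x, y))) => // x _.
  by apply: cvg_pair; [exact: cvg_id|exact: cvg_cst].
apply/lee_addgt0Pr => e e0.
pose m := fine (mu setT); pose M := fine (nu setT).
have m0 : (0 <= m)%R by exact: fine_ge0.
(* Chosen so that [d * (m + 1) = e]: the part [d * m] pays for the discretisation, and [d] for the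
   [N] errors [eta], whose sum is below [1]. Below, [N] is such that [N.+1 * d] bounds every slice
   measure. *)
pose d := (e / (m + 1))%R.
have d0 : (0 < d)%R by rewrite divr_gt0// ltr_wpDl.
pose N := Num.bound (M / d).
have MN : (M <= N.+1%:R * d)%R.
  have Md0 : (0 <= M / d)%R by rewrite divr_ge0 ?(ltW d0)//; exact: fine_ge0.
  by rewrite -ler_pdivrMr// (le_trans (ltW (archi_boundP Md0)))// ler_nat.
pose U (j : nat) := [set x | (j.+1%:R * d)%:E < nu (sliceX E x)].
have oU j : open (U j) by exact: (open_slice_lsc hY cid inu).
pose eta : R := N.+1%:R^-1%R.
have eta0 : (0 < eta)%R by rewrite invr_gt0.
have /choice[K KP] : forall j : nat, exists K : set X,
    [/\ compact K, K `<=` U j & mu (U j) <= mu K + eta%:E].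
  move=> j; have muU : mu (U j) - eta%:E < mu (U j).
    by rewrite lteBlDr// lteDl ?lte_fin// fmu//; exact: open_borel.
  have [K [cK KU UK]] := imu (oU j) muU.
  by exists K; split => //; rewrite -leeBlDr// ltW.
have /choice[S SP] : forall j : nat, exists S : set (borelT X * borelT Y),
    [/\ measurable S, S `<=` E &
     forall x, K j x -> (j.+1%:R * d)%:E < nu (sliceX S x)].
  move=> j; have [cK KU _] := KP j.
  by apply: compact_layer => //; rewrite mulr_ge0// ltW.
pose T : set (borelT X * borelT Y) := \big[setU/set0]_(j < N) S j.
have mT : measurable T by apply: bigsetU_measurable => j _; have [] := SP j.
have TE : T `<=` E.
  by rewrite /T -bigcup_mkord => z [j _ Sz]; have [_ SE _] := SP j; exact: SE.
have ST j : (j < N)%N -> S j `<=` T.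
  by move=> jN z Sz; rewrite /T -bigcup_mkord; exists j.
have mK j : measurable (K j : set (borelT X)).
  by apply: compact_borel => //; have [] := KP j.
have secX : (fun x => nu (sliceX T x)) = nu \o @xsection (borelT X) (borelT Y) T.
  by apply/funext => x /=; rewrite xsectionE.
have secY : (fun y => mu (sliceY T y)) = mu \o @ysection (borelT X) (borelT Y) T.
  by apply/funext => y /=; rewrite ysectionE.
have mU1 j : measurable_fun [set: borelT X] (fun x => (\1_(U j) x)%:E : \bar R).
  by apply/measurable_EFinP; apply: measurable_indic; exact: open_borel.
have mK1 j : measurable_fun [set: borelT X] (fun x => (\1_(K j) x)%:E : \bar R).
  by apply/measurable_EFinP; exact: measurable_indic.
have s1 : \int[mu]_x nu (sliceX E x) <=
    d%:E * (m%:E + \sum_(j < N) mu (U j)).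
  apply: (@le_trans _ _ (\int[mu]_x (d%:E * (1 + \sum_(j < N) (\1_(U j) x)%:E)))).
    apply: ge0_le_integral => //.
    - apply: measurable_funeM; apply: emeasurable_funD => //.
      by apply: emeasurable_sum => j; exact: mU1.
    - move=> x _; rewrite -(fineK (fnu _ (open_borel (oEX x)))).
      rewrite sumEFin -EFinD -EFinM lee_fin.
      set r := fine _.
      rewrite (eq_bigr (fun j : 'I_N => (j.+1%:R * d < r)%R%:R)) => [|j _].
        apply: le_layers; first exact: ltW.
        apply: le_trans MN; apply: fine_le; rewrite ?fnu//; first exact: open_borel.
        by apply: le_measure; rewrite ?inE//; exact: open_borel.
      rewrite indicE; congr (nat_of_bool _)%:R; apply/idP/idP.
        by rewrite inE /U /= -(fineK (fnu _ (open_borel (oEX x)))) lte_fin.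
      by rewrite inE /U /= -(fineK (fnu _ (open_borel (oEX x)))) lte_fin.
  rewrite ge0_integralZl//; last 3 first.
  - apply: emeasurable_funD => //.
    by apply: emeasurable_sum => j; exact: mU1.
  - by move=> x _; rewrite adde_ge0// sume_ge0// => j _; rewrite lee_fin.
  - by rewrite lee_fin ltW.
  rewrite lee_wpmul2l ?lee_fin ?(ltW d0)//.
  rewrite ge0_integralD//; last 2 first.
  - by move=> x _; rewrite sume_ge0// => j _; rewrite lee_fin.
  - by apply: emeasurable_sum => j; exact: mU1.
  rewrite integral_cst// mul1e /m fineK ?fmu// leeD2l//.
  rewrite ge0_integral_sum//.
  apply: lee_sum => j _; rewrite integral_indic ?setIT//; exact: open_borel.
have s2 : d%:E * \sum_(j < N) mu (K j) <= \int[mu]_x nu (sliceX T x).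
  rewrite (eq_bigr (fun j : 'I_N => \int[mu]_x (\1_(K j) x)%:E)) => [|j _]; last first.
    by rewrite integral_indic// setIT.
  rewrite -ge0_integral_sum//.
  rewrite -ge0_integralZl//; last 3 first.
  - by apply: emeasurable_sum => j; exact: mK1.
  - by move=> x _; rewrite sume_ge0// => j _; rewrite lee_fin.
  - by rewrite lee_fin ltW.
  apply: ge0_le_integral => //.
  - move=> x _; apply: mule_ge0; first by rewrite lee_fin ltW.
    by apply: sume_ge0 => j _; rewrite lee_fin.
  - by apply: measurable_funeM; apply: emeasurable_sum => j; exact: mK1.
  - by rewrite secX; exact: measurable_fun_xsection.
  - move=> x _; rewrite -(fineK (fnu _ (mX _ x mT))) sumEFin -EFinM lee_fin.
    have xK j : \1_(K j) x = (x \in K j)%:R :> R by rewrite indicE.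
    under eq_bigr do rewrite xK.
    apply: (layers_le (b := fun j => x \in K j)) => //; first exact: ltW.
      exact: fine_ge0.
    move=> j jN; rewrite inE => Kx; have [mS _ /(_ _ Kx) hS] := SP j.
    rewrite -lee_fin fineK ?fnu//; last exact: mX.
    apply: (le_trans (ltW hS)); apply: le_measure; rewrite ?inE.
    + exact: mX.
    + exact: mX.
    + by move=> y /=; exact: ST.
have s3 : \int[mu]_x nu (sliceX T x) = \int[nu]_y mu (sliceY T y).
  have := @indic_fubini_tonelli _ _ (borelT X) (borelT Y) R mu nu T mT.
  by rewrite indic_fubini_tonelli_FE// indic_fubini_tonelli_GE// -secX -secY.
have s4 : \int[nu]_y mu (sliceY T y) <= \int[nu]_y mu (sliceY E y).
  apply: ge0_le_integral => //.
  - by rewrite secY; exact: measurable_fun_ysection.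
  - move=> y _; apply: le_measure; rewrite ?inE.
    + exact: mY.
    + exact: open_borel.
    + by move=> x /=; exact: TE.
apply: (le_trans s1).
have -> : e%:E = d%:E * (m%:E + 1).
  by rewrite -EFinD -EFinM /d divfK// gt_eqF// ltr_wpDl.
rewrite [leRHS]addeC -[leRHS]/(_ + _).
apply: (@le_trans _ _ (d%:E * (m%:E + 1) + d%:E * \sum_(j < N) mu (K j))); last first.
  by rewrite leeD2l// (le_trans s2)// s3.
rewrite -muleDr//.
rewrite lee_wpmul2l ?lee_fin ?(ltW d0)// -addeA leeD2l//.
apply: (@le_trans _ _ (\sum_(j < N) (mu (K j) + eta%:E))).
  by apply: lee_sum => j _; have [] := KP j.
rewrite big_split /= addeC leeD2r// sumEFin lee_fin sumr_const card_ord.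
by rewrite -mulr_natr mulrC ler_pdivrMr// mul1r ler_nat.
Qed.

End tonelli_open.

Section constant_kernel.
Context {R : realType} d (T : measurableType d).
Variable mu : {finite_measure set T -> \bar R}.
Local Open Scope ereal_scope.

(** Regarding [mu] as a kernel from a one-point space turns an iterated integral into an integral
    against a composition [kcomp] of kernels. *)
Definition constant_kernel (_ : unit) : {measure set T -> \bar R} := mu.

HB.instance Definition _ := isKernel.Build _ _ _ _ _ constant_kernel
  (fun U _ => measurable_cst (mu U)).

Let constant_kernel_uub : measure_fam_uub constant_kernel.
Proof.
exists (fine (mu setT) + 1)%R => x.
by rewrite EFinD fineK ?fin_num_measure// lteDl ?fin_num_measure// lte_fin.
Qed.

HB.instance Definition _ := Kernel_isFinite.Build _ _ _ _ R constant_kernel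
  constant_kernel_uub.

Definition constant_fker : R.-fker unit ~> T := constant_kernel.

End constant_kernel.

(** * Tonelli's theorem for finite inner regular measures *)

Section tonelli_finite.
Context {R : realType} (X Y : ptopologicalType).
Hypotheses (hX : hausdorff_space X) (hY : hausdorff_space Y).
Variables (mu : {finite_measure set (borelT X) -> \bar R}).
Variables (nu : {finite_measure set (borelT Y) -> \bar R}).
Hypotheses (imu : inner_open mu) (inu : inner_open nu).
Local Open Scope ereal_scope.

Let cid : continuous (fun z : X * Y => z).
Proof. by move=> z; exact: cvg_id. Qed.

Let cswap : continuous (fun z : Y * X => (z.2, z.1)).
Proof. by move=> z; apply: cvg_pair; [exact: cvg_snd|exact: cvg_fst]. Qed.

Lemma tonelli_open (E : set (X * Y)) : open E ->
  \int[mu]_x nu [set y | E (x, y)] = \int[nu]_y mu [set x | E (x, y)].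
Proof.
move=> oE; apply/eqP; rewrite eq_le tonelli_open_le//=.
have oE' : open [set z : Y * X | E (z.2, z.1)].
  by apply: (open_comp (f := fun z : Y * X => (z.2, z.1))) => // z _; exact: cswap.
exact: (tonelli_open_le hY hX inu imu oE').
Qed.

Variable F : X * Y -> \bar R.
Hypotheses (F0 : forall z, 0 <= F z)
  (mF : measurable_fun [set: borelT (X * Y)%type] F).

Let kX := slice_fker hY cid inu.
Let kY := slice_fker hX cswap imu.

Let pairX_measurable x : measurable_fun [set: borelT Y]
  ((fun y => (x, y)) : borelT Y -> borelT (X * Y)%type).
Proof.
apply: continuous_borel => y.
by apply: cvg_pair; [exact: cvg_cst|exact: cvg_id].
Qed.

Let pairY_measurable y : measurable_fun [set: borelT X]
  ((fun x => (x, y)) : borelT X -> borelT (X * Y)%type).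
Proof.
apply: continuous_borel => x.
by apply: cvg_pair; [exact: cvg_id|exact: cvg_cst].
Qed.

Let integral_kX x : \int[kX (tt, x)]_z F z = \int[nu]_y F (x, y).
Proof.
rewrite [LHS](ge0_integral_pushforward (pairX_measurable x))//.
Qed.

Let integral_kY y : \int[kY (tt, y)]_z F z = \int[mu]_x F (x, y).
Proof.
rewrite [LHS](ge0_integral_pushforward (pairY_measurable y))//.
Qed.

Lemma measurable_tonelliX : measurable_fun [set: borelT X]
  (fun x => \int[nu]_y F (x, y)).
Proof.
under eq_fun do rewrite -integral_kX.
apply: (measurable_fun_integral_kernel (l := fun x : borelT X => kX (tt, x))) => //.
move=> U mU; exact: (measurable_slice hY cid inu mU).
Qed.

(** Each iterated integral is the integral of [F] against a finite Borel measure on [X * Y]. The two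
    measures agree on open sets, which form a generating class stable under intersection, so they
    coincide. *)
Lemma tonelli_finite :
  \int[mu]_x \int[nu]_y F (x, y) = \int[nu]_y \int[mu]_x F (x, y).
Proof.
have <- : \int[kcomp (constant_fker mu) kX tt]_z F z =
    \int[mu]_x \int[nu]_y F (x, y).
  by rewrite integral_kcomp//; apply: eq_integral => x _; rewrite integral_kX.
have <- : \int[kcomp (constant_fker nu) kY tt]_z F z =
    \int[nu]_y \int[mu]_x F (x, y).
  by rewrite integral_kcomp//; apply: eq_integral => x _; rewrite integral_kY.
apply: eq_measure_integral => A mA _.
apply: (@measure_unique _ R (borelT (X * Y)%type) (@open (X * Y)%type) (fun=> setT) erefl) => //.
- exact: openI.
- by move=> _; exact: openT.
- exact: bigcup_const.
- by move=> U oU; exact: tonelli_open.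
- move=> _.
  have : \int[mu]_x cst (nu setT) x < +oo.
    by rewrite integral_cst// ltey_eq fin_numM ?fin_num_measure.
  exact.
Qed.

End tonelli_finite.

(** * Haar measure *)

(* Haar measure need not be sigma-finite, hence Tonelli's theorem below is
   restricted to functions with sigma-bounded support; every integrable function
   is one. *)
Definition sigma_bounded (T : topologicalType) (S : set T) :=
  exists2 K : nat -> set T, (forall n, compact (K n)) & S `<=` \bigcup_n K n.

Lemma sub_sigma_bounded (T : topologicalType) (A B : set T) :
  A `<=` B -> sigma_bounded B -> sigma_bounded A.
Proof. by move=> AB [K cK BK]; exists K => //; exact: subset_trans BK. Qed.

Lemma compact_sigma_bounded (T : topologicalType) (K : set T) :
  compact K -> sigma_bounded K.
Proof. by move=> cK; exists (fun=> K) => // x Kx; exists 0%N. Qed.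

Lemma bigcup_sigma_bounded (T : topologicalType) (S : nat -> set T) :
  (forall n, sigma_bounded (S n)) -> sigma_bounded (\bigcup_n S n).
Proof.
move=> /(_ _)/cid2-/all_sig[K KP].
exists (fun n => if unpickle n is Some (i, j) then K i j else set0).
  move=> n; case: (unpickle n) => [[i j]|]; last exact: compact0.
  by have [+ _] := KP i; exact.
move=> x [i _ Six]; have [_ /(_ _ Six)[j _ Kx]] := KP i.
by exists (pickle (i, j)) => //; rewrite pickleK.
Qed.

Lemma sigma_boundedX (T U : topologicalType) (A : set T) (B : set U) :
  sigma_bounded A -> sigma_bounded B -> sigma_bounded (A `*` B).
Proof.
move=> [K cK AK] [L cL BL].
apply: (@sub_sigma_bounded _ _ (\bigcup_i \bigcup_j (K i `*` L j))).
  by move=> [x y] /= [/AK[i _ Kx] /BL[j _ Ly]]; exists i => //; exists j.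
apply: bigcup_sigma_bounded => i; apply: bigcup_sigma_bounded => j.
by apply: compact_sigma_bounded; exact: compact_setX.
Qed.

Lemma image_sigma_bounded (T U : topologicalType) (f : T -> U) (A : set T) :
  continuous f -> sigma_bounded A -> sigma_bounded (f @` A).
Proof.
move=> cf [K cK AK]; exists (fun n => f @` K n).
  by move=> n; exact: compact_image.
by move=> _ [x /AK[n _ Kx] <-]; exists n => //; exists x.
Qed.

Lemma sigma_bounded_mulg (G : topologicalGroupType) (A B : set G) :
  sigma_bounded A -> sigma_bounded B ->
  sigma_bounded [set (a * b)%g | a in A & b in B].
Proof.
move=> sA sB; have := image_sigma_bounded
  (@mulg_continuous G) (sigma_boundedX sA sB).
apply: sub_sigma_bounded => _ [a Aa [b Bb <-]].
by exists (a, b).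
Qed.

Section haar.
Context {R : realType} {G : topologicalGroupType}.
Variable mu : {measure set (borel G) -> \bar R}.
Hypotheses (hG : hausdorff_space G) (lcG : locally_compact [set: G])
  (haar : left_haar_measure mu).
Local Open Scope ereal_scope.

Lemma haar_inner_open : inner_open (mu : set (borelT G) -> \bar R).
Proof.
move=> U a oU; rewrite (haar_inner haar oU) => /ereal_sup_gt[_ [K [cK KU] <-] aK].
by exists K.
Qed.

Lemma mulgl_borel x :
  measurable_fun [set: borel G] ((fun y : G => (x * y)%g) : borel G -> borel G).
Proof. by apply: continuous_borel; exact: continuous_mulgl. Qed.

Lemma haar_preimage x (A : set (borel G)) : measurable A ->
  mu [set y : G | A (x * y)%g] = mu A.
Proof.
move=> mA; rewrite -(haar_left haar x^-1%g mA); congr (mu _).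
apply/seteqP; split => [y Ay|_ [y Ay <-]] /=; last by rewrite mulVKg.
by exists (x * y)%g => //; rewrite mulKg.
Qed.

Lemma haar_integral x (f : borel G -> \bar R) :
  measurable_fun [set: borel G] f -> (forall y, 0 <= f y) ->
  \int[mu]_y f ((x * y)%g : borel G) = \int[mu]_y f y.
Proof.
move=> mf f0.
have := @ge0_integral_pushforward _ _ _ _ R _ (mulgl_borel x) mu setT f
  measurableT mf (fun y _ => f0 y).
rewrite preimage_setT => <-; apply: eq_measure_integral => [|mx A mA _].
  exact: mulgl_borel.
exact: (haar_preimage x mA).
Qed.

Lemma compact_open_finite (K : set G) : compact K ->
  exists U : set G, [/\ open U, K `<=` U & mu U < +oo].
Proof.
move=> cK; have mK : measurable (K : set (borel G)) by exact: compact_borel.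
have := haar_compact haar cK; rewrite (haar_outer haar mK).
by move=> /ereal_inf_lt[_ [U [oU KU] <-] Uoo]; exists U.
Qed.

Lemma sigma_bounded_open_finite (S : set G) : sigma_bounded S ->
  exists U : nat -> set G, [/\ forall n, open (U n), forall n, mu (U n) < +oo,
    forall m n, (m <= n)%N -> U m `<=` U n & S `<=` \bigcup_n U n].
Proof.
move=> [K cK SK].
have /choice[V VP] : forall n, exists U : set G, [/\ open U, K n `<=` U & mu U < +oo].
  by move=> n; exact: compact_open_finite.
pose U n := \big[setU/set0]_(i < n.+1) V i.
have oU n : open (U n).
  by rewrite /U -bigcup_mkord; apply: bigcup_open => i _; have [] := VP i.
exists U; split => //.
- elim=> [|n IH]; first by rewrite /U big_ord_recr big_ord0 /= set0U; have [] := VP 0%N.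
  rewrite /U big_ord_recr /= -/(U n).
  apply: le_lt_trans (measureU2 _ _ _) _.
  + exact: open_borel.
  + by apply: open_borel; have [] := VP n.+1.
  + by apply: lte_add_pinfty => //; have [] := VP n.+1.
- move=> m n mn; rewrite /U -!bigcup_mkord => x [i /= im Vx]; exists i => //=.
  exact: leq_trans mn.
- move=> x /SK[n _ Kx]; exists n => //; rewrite /U -bigcup_mkord.
  by exists n => /=; rewrite ?ltnSn//; have [_ + _] := VP n; exact.
Qed.

(** Were [U] null, finitely many translates of it would cover any compact set, making it null; inner
    regularity on the whole group would then give [mu = 0]. *)
Lemma haar_open_gt0 (U : set G) : open U -> U !=set0 -> 0 < mu U.
Proof.
move=> oU [u Uu]; rewrite lt_neqAle measure_ge0 andbT eq_sym; apply/eqP => U0.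
have /eqP := haar_neq0 haar; apply.
rewrite (haar_inner haar openT); apply/eqP; rewrite eq_le; apply/andP; split; last first.
  by apply: ereal_sup_ubound; exists set0; [split => //; exact: compact0|rewrite measure0].
apply: ge_ereal_sup => _ [K [cK _] <-].
suff [N [mN N0 KN]] : exists N : set (borel G),
    [/\ measurable N, mu N = 0 & K `<=` N].
  by rewrite -N0; apply: le_measure; rewrite ?inE//; exact: compact_borel.
apply: (compact_ind (P := fun A => exists N : set (borel G),
  [/\ measurable N, mu N = 0 & A `<=` N]) cK).
- by exists set0; split.
- move=> A B [M [mM M0 AM]] [N [mN N0 BN]]; exists (M `|` N); split.
  + exact: measurableU.
  + apply/eqP; rewrite eq_le measure_ge0 andbT.
    by apply: le_trans (measureU2 _ _ _) _ => //; rewrite -[leLHS]/(mu M + mu N) M0 N0 adde0.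
  + exact: setUSS.
- by move=> A B AB [N [mN N0 BN]]; exists N; split => //; exact: subset_trans BN.
- move=> x _; exists [set y | U (u * x^-1 * y)%g].
    apply: open_nbhs_nbhs; split; first exact: open_mulgl.
    by rewrite /= mulgVK.
  exists [set y : G | U (u * x^-1 * y)%g]; split => //.
    by apply: open_borel; exact: open_mulgl.
  by rewrite haar_preimage//; exact: open_borel.
Qed.

(* With compact sets [K n] exhausting [U] up to a null set and [V] a compact
   neighbourhood of the identity, an [x] in [U] outside all the [K n V] would
   have a whole neighbourhood in that null set. *)
Lemma finite_open_sigma_bounded (U : set G) : open U -> mu U < +oo ->
  sigma_bounded U.
Proof.
move=> oU Uoo.
have mU : measurable (U : set (borel G)) by exact: open_borel.
have [V cV nV] := nbhs1_compact hG lcG.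
have /choice[K KP] : forall n : nat, exists K : set G,
    [/\ compact K, K `<=` U & mu U - n.+1%:R^-1%:E < mu K].
  move=> n; apply: (haar_inner_open oU).
  by rewrite lteBlDr// lteDl ?lte_fin ?invr_gt0// ge0_fin_numE.
pose D := U `\` \bigcup_n K n.
have mK n : measurable (K n : set (borel G)) by apply: compact_borel => //; have [] := KP n.
have mKK : measurable (\bigcup_n K n : set (borel G)) by exact: bigcupT_measurable.
have D0 : mu D = 0.
  apply/eqP; rewrite eq_le measure_ge0 andbT; apply/lee_addgt0Pr => e e0.
  rewrite add0e; pose n := Num.bound e^-1.
  have ne : (n.+1%:R^-1 <= e :> R)%R.
    rewrite invf_ple ?posrE//.
    have : (0 <= e^-1)%R by rewrite invr_ge0 ltW.
    by move=> /archi_boundP/ltW/le_trans; apply; rewrite ler_nat.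
  have [_ KU UK] := KP n.
  apply: (@le_trans _ _ (mu (U `\` K n))).
    apply: le_measure; rewrite ?inE.
    - exact: measurableD.
    - exact: measurableD.
    - by apply: setDS; exact: bigcup_sup.
  rewrite measureD// (setIidr KU) leeBlDr; last first.
    by rewrite ge0_fin_numE// (le_lt_trans _ Uoo)// le_measure ?inE.
  move: UK; rewrite lteBlDr// => /ltW/le_trans; apply.
  by rewrite addeC leeD2r// lee_fin.
have sV : sigma_bounded [set (a * b)%g | a in \bigcup_n K n & b in V].
  apply: sigma_bounded_mulg; last exact: compact_sigma_bounded.
  by apply: bigcup_sigma_bounded => n; apply: compact_sigma_bounded; have [] := KP n.
apply: sub_sigma_bounded sV => x Ux; apply: contrapT => nx.
have [W nW WV] := nbhs1_div nV.
pose B := [set y | U y /\ W° (x^-1 * y)%g].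
have oB : open B by apply: openI => //; apply: open_mulgl; exact: open_interior.
have Bx : B x.
  by split => //; rewrite mulVg.
have := haar_open_gt0 oB (ex_intro _ x Bx).
apply/negP; rewrite -leNgt -D0; apply: le_measure; rewrite ?inE.
- exact: open_borel.
- exact: measurableD.
- move=> y [Uy Wy]; split => // Ky; apply: nx.
  exists y => //; exists ((x^-1 * y)^-1 * 1)%g.
    by apply: WV; [exact: interior_subset|exact: nbhs_singleton].
  by rewrite mulg1 invgM invgK mulVKg.
Qed.

(** Each set where [|f|] is at least [n.+1^-1] has finite measure. Outer regularity places it in an
    open set of finite measure, and such open sets are sigma-bounded. *)
Lemma integrable_sigma_bounded (f : borel G -> \bar R) :
  mu.-integrable setT f -> sigma_bounded [set x : G | f x != 0].
Proof.
move=> /integrableP[mf foo].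
apply: (@sub_sigma_bounded _ _ (\bigcup_n [set x : G | n.+1%:R^-1%:E <= `|f x|])).
  move=> x /= fx0; have [fxoo|fxoo] := eqVneq `|f x| +oo.
    by exists 0%N => //=; rewrite fxoo leey.
  have fin : `|f x| \is a fin_num by rewrite ge0_fin_numE// ltey.
  have r0 : (0 < fine `|f x|)%R.
    by rewrite fine_gt0// ltey fxoo andbT lt_neqAle abse_ge0 andbT eq_sym abse_eq0.
  pose n := Num.bound (fine `|f x|)^-1.
  exists n => //=; rewrite -(fineK fin) lee_fin invf_ple ?posrE//.
  have : (0 <= (fine `|f x|)^-1)%R by rewrite invr_ge0 ltW.
  by move=> /archi_boundP/ltW/le_trans; apply; rewrite ler_nat.
apply: bigcup_sigma_bounded => n; set A := [set x : G | _].
have mA : measurable (A : set (borel G)).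
  rewrite -[X in measurable X]setTI; apply: emeasurable_fun_c_infty => //.
  exact: measurableT_comp.
have n0 : (0 < n.+1%:R^-1 :> R)%R by rewrite invr_gt0.
have Aoo : mu A < +oo.
  have := le_integral_abse mu measurableT mf n0; rewrite setTI -/A => h.
  have := le_lt_trans h foo.
  by rewrite !ltey; apply: contra => /eqP ->; rewrite gt0_muley ?lte_fin.
have := Aoo; rewrite (haar_outer haar mA) => /ereal_inf_lt[_ [U [oU AU] <-] Uoo].
apply: sub_sigma_bounded AU _; exact: finite_open_sigma_bounded.
Qed.

End haar.

Lemma measurable_pairl (G : topologicalGroupType) (d : measure_display)
  (T : measurableType d) (F : G * G -> T) (x : G) :
  measurable_fun [set: borelT (G * G)%type] F ->
  measurable_fun [set: borel G] (fun y : borel G => F (x, y)).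
Proof.
move=> mF; apply: (measurableT_comp mF); apply: continuous_borel => y.
by apply: cvg_pair; [exact: cvg_cst|exact: cvg_id].
Qed.

Lemma measurable_pairr (G : topologicalGroupType) (d : measure_display)
  (T : measurableType d) (F : G * G -> T) (y : G) :
  measurable_fun [set: borelT (G * G)%type] F ->
  measurable_fun [set: borel G] (fun x : borel G => F (x, y)).
Proof.
move=> mF; apply: (measurableT_comp mF); apply: continuous_borel => x.
by apply: cvg_pair; [exact: cvg_id|exact: cvg_cst].
Qed.

(** * Tonelli's theorem for Haar measure *)

Section haar_tonelli.
Context {R : realType} {G : topologicalGroupType}.
Variable mu : {measure set (borel G) -> \bar R}.
Hypotheses (hG : hausdorff_space G) (lcG : locally_compact [set: G])
  (haar : left_haar_measure mu).
Local Open Scope ereal_scope.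

Section restriction.
Variables (U : set G) (oU : open U) (Uoo : mu U < +oo).

Let nu : {finite_measure set (borelT G) -> \bar R} := mfrestr (open_borel oU) Uoo.

Lemma integral_mfrestr_open (f : borel G -> \bar R) :
  (forall x, f x != 0 -> U x) -> \int[nu]_x f x = \int[mu]_x f x.
Proof.
move=> fU; have fE : f = f \_ (U : set (borel G)).
  apply/funext => x; rewrite /patch; case: ifPn => //; apply: contraNeq => /fU.
  by rewrite inE.
rewrite fE -2!integral_mkcond; apply: eq_measure_integral => A mA AU.
by rewrite /nu /= /mfrestr /mrestr setIidl.
Qed.

Lemma mfrestr_inner_open : inner_open nu.
Proof.
move=> V a oV aV.
have [K [cK KUV aK]] := haar_inner_open haar (openI oV oU) aV.
exists K; split => //; first by move=> x /KUV[].
by rewrite /nu /= /mfrestr /mrestr setIidl// => x /KUV[].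
Qed.

End restriction.

Lemma cvg_integral_patch (f : borel G -> \bar R) (U : nat -> set G) :
  measurable_fun [set: borel G] f -> (forall x, 0 <= f x) ->
  (forall n, open (U n)) -> (forall m n, (m <= n)%N -> U m `<=` U n) ->
  (forall x, f x != 0 -> (\bigcup_n U n) x) ->
  \int[mu]_x (f \_ (U n : set (borel G))) x @[n --> \oo] --> \int[mu]_x f x.
Proof.
move=> mf f0 oU ndU fU.
have ndf x : nondecreasing_seq (fun n => (f \_ (U n : set (borel G))) x).
  move=> m n mn; rewrite /patch; case: ifPn => [|_]; last by case: ifP.
  by rewrite inE => /(ndU _ _ mn) Ux; rewrite mem_set.
have -> : \int[mu]_x f x =
    \int[mu]_x limn (fun n => (f \_ (U n : set (borel G))) x).
  apply: eq_integral => x _; apply/esym/cvg_lim => //.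
  have [fx0|/fU[N _ Ux]] := eqVneq (f x) 0.
    rewrite (_ : (fun _ => _) = cst (f x)); first exact: cvg_cst.
    by apply/funext => n; rewrite /patch fx0 if_same.
  apply: cvg_near_cst; near=> n.
  rewrite /patch mem_set//; apply: (ndU N) => //; near: n; exact: nbhs_infty_ge.
apply: (@cvg_monotone_convergence _ _ _ mu setT measurableT).
- move=> n; apply/(measurable_restrictT _ _).1; first exact: open_borel.
  exact: measurable_funTS.
- by move=> n x _; rewrite /patch; case: ifP.
- by move=> x _; exact: ndf.
Unshelve. all: by end_near. Qed.

Lemma cvg_integral2 (Fn : nat -> G * G -> \bar R) (F : G * G -> \bar R) :
  (forall n z, 0 <= Fn n z) ->
  (forall n x, measurable_fun [set: borel G] (fun y : borel G => Fn n (x, y))) ->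
  (forall n, measurable_fun [set: borel G]
    (fun x : borel G => \int[mu]_y Fn n (x, y))) ->
  (forall z, nondecreasing_seq (Fn ^~ z)) ->
  (forall z, Fn n z @[n --> \oo] --> F z) ->
  \int[mu]_x \int[mu]_y Fn n (x, y) @[n --> \oo] --> \int[mu]_x \int[mu]_y F (x, y).
Proof.
move=> Fn0 mFn mIFn ndFn FnF.
rewrite (_ : \int[mu]_x \int[mu]_y F (x, y) =
    \int[mu]_x limn (fun n => \int[mu]_y Fn n (x, y))).
  apply: (@cvg_monotone_convergence _ _ _ mu setT measurableT) => //.
  - by move=> n x _; exact: integral_ge0.
  - by move=> x _ m n mn; apply: ge0_le_integral => // y _; exact: ndFn.
apply: eq_integral => x _; apply/esym/cvg_lim => //.
rewrite (_ : \int[mu]_y F (x, y) = \int[mu]_y limn (fun n => Fn n (x, y))).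
  exact: (@cvg_monotone_convergence _ _ _ mu setT measurableT).
by apply: eq_integral => y _; apply/esym/cvg_lim => //; exact: FnF.
Qed.

Variable F : G * G -> \bar R.
Hypotheses (F0 : forall z, 0 <= F z)
  (mF : measurable_fun [set: borelT (G * G)%type] F).

(** Restricting [y] to [U n] makes the inner measure finite, and the integral wanted is the limit of
    these measurable functions of [x]. *)
Lemma measurable_haar_tonelli (S : set G) : sigma_bounded S ->
  (forall x y, F (x, y) != 0 -> S y) ->
  measurable_fun [set: borel G] (fun x : borel G => \int[mu]_y F (x, y)).
Proof.
move=> /(sigma_bounded_open_finite hG haar)[U [oU Uoo ndU SU]] FS.
apply: (emeasurable_fun_cvg (fun n (x : borel G) => \int[mu]_y
    ((fun y : borel G => F (x, y)) \_ (U n : set (borel G))) y)); last first.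
  move=> x _; apply: cvg_integral_patch => //; first exact: measurable_pairl.
  by move=> y /FS/SU.
move=> n; pose Fn := F \_ [set z | U n z.2].
have oUn : open [set z : G * G | U n z.2].
  by apply: (open_comp (f := fun z : G * G => z.2)) => // z _; exact: cvg_snd.
have Fn0 z : 0 <= Fn z by rewrite /Fn /patch; case: ifP.
have mFn : measurable_fun [set: borelT (G * G)%type] Fn.
  apply/(measurable_restrictT _ _).1; first exact: open_borel.
  exact: measurable_funTS.
rewrite (_ : (fun x => _) = (fun x => \int[mfrestr (open_borel (oU n)) (Uoo n)]_y Fn (x, y))).
  apply: (@measurable_tonelliX R G G hG) => //.
  exact: mfrestr_inner_open.
apply/funext => x; rewrite integral_mfrestr_open.
  apply: eq_integral => y _; rewrite /Fn /patch.
  by congr (if _ then _ else _); apply/idP/idP => /set_mem Uy; exact: mem_set.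
by move=> y; rewrite /Fn /patch; case: ifPn => [/set_mem//|_]; rewrite eqxx.
Qed.

(** Both iterated integrals are monotone limits of their truncations to [U n * U n], where [mu] may
    be replaced by a finite inner regular restriction. *)
Lemma haar_tonelli (S T : set G) : sigma_bounded S -> sigma_bounded T ->
  (forall x y, F (x, y) != 0 -> S x /\ T y) ->
  \int[mu]_x \int[mu]_y F (x, y) = \int[mu]_y \int[mu]_x F (x, y).
Proof.
move=> sS sT FST.
have [|U [oU Uoo ndU STU]] := @sigma_bounded_open_finite _ _ mu hG haar (S `|` T).
  rewrite -bigcup2E; apply: bigcup_sigma_bounded => -[|[|n]] //=.
  by apply: compact_sigma_bounded; exact: compact0.
pose A n : set (borelT (G * G)%type) := U n `*` U n.
have oA n : open (U n `*` U n).
  rewrite (_ : _ `*` _ = [set z | U n z.1] `&` [set z | U n z.2])//.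
  apply: openI; last first.
    by apply: (open_comp (f := fun z : G * G => z.2)) => // z _; exact: cvg_snd.
  by apply: (open_comp (f := fun z : G * G => z.1)) => // z _; exact: cvg_fst.
pose Fn n := F \_ (A n).
have Fn0 n z : 0 <= Fn n z by rewrite /Fn /patch; case: ifP.
have mFn n : measurable_fun [set: borelT (G * G)%type] (Fn n).
  apply/(measurable_restrictT _ _).1; first exact: (open_borel (oA n)).
  exact: measurable_funTS.
have FnU n x y : Fn n (x, y) != 0 -> U n x /\ U n y.
  rewrite /Fn /patch; have [/set_mem[]//|_] := boolP ((x, y) \in A n).
  by rewrite eqxx.
pose nu n : {finite_measure set (borelT G) -> \bar R} :=
  mfrestr (open_borel (oU n)) (Uoo n).
have inu n : inner_open (nu n) by exact: mfrestr_inner_open.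
have iFn n x : \int[nu n]_y Fn n (x, y) = \int[mu]_y Fn n (x, y).
  by apply: integral_mfrestr_open => y /FnU[].
have iFn' n y : \int[nu n]_x Fn n (x, y) = \int[mu]_x Fn n (x, y).
  by apply: integral_mfrestr_open => x /FnU[].
(* The outer integral can pass to the restricted measure only because the inner one vanishes off
   [U n]. *)
have iFn0 n x : ~ U n x -> \int[mu]_y Fn n (x, y) = 0.
  by move=> Ux; apply: integral0_eq => y _; apply/eqP; apply: contra_notT Ux => /FnU[].
have iFn0' n y : ~ U n y -> \int[mu]_x Fn n (x, y) = 0.
  by move=> Uy; apply: integral0_eq => x _; apply/eqP; apply: contra_notT Uy => /FnU[].
have tonn n : \int[mu]_x \int[mu]_y Fn n (x, y) =
    \int[mu]_y \int[mu]_x Fn n (x, y).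
  transitivity (\int[nu n]_x \int[nu n]_y Fn n (x, y)).
    rewrite integral_mfrestr_open => [|x].
      by apply: eq_integral => x _; rewrite iFn.
    by rewrite iFn; apply: contraPP => /iFn0 ->; rewrite eqxx.
  rewrite (tonelli_finite hG hG (inu n) (inu n))//.
  rewrite integral_mfrestr_open => [|y].
    by apply: eq_integral => y _; rewrite iFn'.
  by rewrite iFn'; apply: contraPP => /iFn0' ->; rewrite eqxx.
have ndFn z : nondecreasing_seq (Fn ^~ z).
  move=> m n mn; rewrite /Fn /patch; case: ifPn => [|_]; last by case: ifP.
  by move=> /set_mem[/(ndU _ _ mn) U1 /(ndU _ _ mn) U2]; rewrite mem_set.
have FnF z : Fn n z @[n --> \oo] --> F z.
  have [Fz0|Fz] := eqVneq (F z) 0.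
    rewrite (_ : (fun _ => _) = cst (F z)); first exact: cvg_cst.
    by apply/funext => n; rewrite /Fn /patch Fz0 if_same.
  case: z Fz => x y /FST[Sx Ty].
  have [m _ Ux] : (\bigcup_n U n) x by apply: STU; left.
  have [k _ Uy] : (\bigcup_n U n) y by apply: STU; right.
  apply: cvg_near_cst; near=> n; rewrite /Fn /patch mem_set//; split => /=.
    by apply: (ndU m) => //; near: n; exact: nbhs_infty_ge.
  by apply: (ndU k) => //; near: n; exact: nbhs_infty_ge.
have c1 : \int[mu]_x \int[mu]_y Fn n (x, y) @[n --> \oo] -->
    \int[mu]_x \int[mu]_y F (x, y).
  apply: cvg_integral2 => //.
  - by move=> n x; exact: (measurable_pairl x (mFn n)).
  - move=> n /=; under eq_fun do rewrite -iFn.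
    exact: (@measurable_tonelliX R G G hG (nu n) (inu n) (Fn n)).
have c2 : \int[mu]_y \int[mu]_x Fn n (x, y) @[n --> \oo] -->
    \int[mu]_y \int[mu]_x F (x, y).
  apply: (@cvg_integral2 (fun n z => Fn n (z.2, z.1)) (fun z => F (z.2, z.1))) => //.
  - by move=> n y; exact: (measurable_pairr y (mFn n)).
  - move=> n /=; under eq_fun do rewrite -iFn'.
    apply: (@measurable_tonelliX R G G hG (nu n) (inu n) (fun z => Fn n (z.2, z.1))) => //.
    apply: (measurableT_comp (mFn n)); apply: continuous_borel.
    exact: swap_continuous.
have e : (fun n => \int[mu]_x \int[mu]_y Fn n (x, y)) =
    (fun n => \int[mu]_y \int[mu]_x Fn n (x, y)).
  by apply/funext => n; exact: tonn.
rewrite e in c1; exact: (cvg_unique _ c1 c2).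
Unshelve. all: by end_near. Qed.

End haar_tonelli.

(** * Convolution *)

Lemma normr_Re_le (R : rcfType) (z : R[i]) :
  `|complex.Re z| <= complex.Re `|z|.
Proof. by case: z => a b; rewrite normc_def /= -sqrtr_sqr ler_wsqrtr// lerDl sqr_ge0. Qed.

Lemma normr_Im_le (R : rcfType) (z : R[i]) :
  `|complex.Im z| <= complex.Re `|z|.
Proof. by case: z => a b; rewrite normc_def /= -sqrtr_sqr ler_wsqrtr// lerDr sqr_ge0. Qed.

Lemma Re_normr_ge0 (R : rcfType) (z : R[i]) : 0 <= complex.Re `|z|.
Proof. by case: z => a b; rewrite normc_def /= sqrtr_ge0. Qed.

Lemma Re_normr_eq0 (R : rcfType) (z : R[i]) : complex.Re `|z| = 0 -> z = 0.
Proof.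
by rewrite normc_def /= => z0; apply/normr0_eq0; rewrite normc_def z0.
Qed.

Lemma Re_normr_le (R : rcfType) (z : R[i]) :
  complex.Re `|z| <= `|complex.Re z| + `|complex.Im z|.
Proof.
case: z => a b; rewrite normc_def /= -(@ler_pXn2r _ 2) ?nnegrE ?sqrtr_ge0 ?addr_ge0//.
rewrite sqr_sqrtr ?addr_ge0 ?sqr_ge0// sqrrD !real_normK ?num_real//.
by rewrite lerD2r lerDl mulrn_wge0// mulr_ge0.
Qed.

Lemma Re_normrM (R : rcfType) (z w : R[i]) :
  complex.Re `|z * w| = complex.Re `|z| * complex.Re `|w|.
Proof. by rewrite normrM !normc_def /= mulr0 subr0. Qed.

Lemma Re_M (R : rcfType) (z w : R[i]) : complex.Re (z * w) =
  complex.Re z * complex.Re w - complex.Im z * complex.Im w.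
Proof. by case: z w => a b [c d]. Qed.

Lemma Im_M (R : rcfType) (z w : R[i]) : complex.Im (z * w) =
  complex.Re z * complex.Im w + complex.Im z * complex.Re w.
Proof. by case: z w => a b [c d] /=. Qed.

Section convolution.
Context {R : realType} {G : topologicalGroupType}.
Variable mu : {measure set (borel G) -> \bar R}.
Hypotheses (hG : hausdorff_space G) (lcG : locally_compact [set: G])
  (haar : left_haar_measure mu).
Local Open Scope ereal_scope.

Lemma measurable_divl : measurable_fun [set: borelT (G * G)%type]
  ((fun z => (z.2^-1 * z.1)%g) : borelT (G * G)%type -> borel G).
Proof.
apply: (@continuous_borel (G * G)%type G); apply: continuousMg; last first.
  by move=> z; exact: cvg_fst.
by apply: continuousVg => z; exact: cvg_snd.
Qed.

Lemma measurable_sndG : measurable_fun [set: borelT (G * G)%type]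
  ((fun z => z.2) : borelT (G * G)%type -> borel G).
Proof. by apply: (@continuous_borel (G * G)%type G) => z; exact: cvg_snd. Qed.

Section ge0_convolution.
Variables u v : borel G -> \bar R.
Hypotheses (mu_ : measurable_fun [set: borel G] u)
  (mv : measurable_fun [set: borel G] v).
Hypotheses (u0 : forall x, 0 <= u x) (v0 : forall x, 0 <= v x).
Hypotheses (su : sigma_bounded [set x : G | u x != 0])
  (sv : sigma_bounded [set x : G | v x != 0]).

Let F (z : G * G) := u z.2 * v ((z.2^-1 * z.1)%g : borel G).

Let mF : measurable_fun [set: borelT (G * G)%type] F.
Proof.
apply: emeasurable_funM.
  exact: (measurableT_comp mu_ measurable_sndG).
exact: (measurableT_comp mv measurable_divl).
Qed.

Let F0 z : 0 <= F z. Proof. by rewrite mule_ge0. Qed.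

Lemma measurable_ge0_convolution : measurable_fun [set: borel G]
  (fun x : borel G => \int[mu]_y (u y * v ((y^-1 * x)%g : borel G))).
Proof.
apply: (measurable_haar_tonelli hG haar F0 mF su) => x y.
by rewrite /F /=; apply: contraNneq => ->; rewrite mul0e.
Qed.

(** The integrand is supported over the product set of the two supports, so the integrals can be
    exchanged; left invariance then removes [y] from the inner one. *)
Lemma integral_ge0_convolution :
  \int[mu]_x \int[mu]_y (u y * v ((y^-1 * x)%g : borel G)) =
  (\int[mu]_y u y) * (\int[mu]_x v x).
Proof.
rewrite (haar_tonelli hG haar F0 mF (sigma_bounded_mulg su sv) su).
  rewrite -ge0_integralZr//; last exact: integral_ge0.
  apply: eq_integral => y _; rewrite /F /= ge0_integralZl//; last first.
    by apply: (measurableT_comp mv); exact: mulgl_borel.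
  by rewrite haar_integral.
move=> x y; rewrite /F /= => uv0.
have uy0 : u y != 0 by apply: contraNneq uv0 => ->; rewrite mul0e.
split => //; exists y => //; exists (y^-1 * x)%g; last by rewrite mulVKg.
by apply: contraNneq uv0 => /= ->; rewrite mule0.
Qed.

End ge0_convolution.

Lemma measurable_Rintegral_pair (F : G * G -> R) (S : set G) :
  measurable_fun [set: borelT (G * G)%type] F -> sigma_bounded S ->
  (forall x y, F (x, y) != 0%R -> S y) ->
  measurable_fun [set: borel G] (fun x : borel G => \int[mu]_y F (x, y))%R.
Proof.
move=> mF sS FS.
have mE : measurable_fun [set: borelT (G * G)%type] (EFin \o F) by exact/measurable_EFinP.
apply: (measurableT_comp (fine_measurable (D := setT) measurableT)).
rewrite (_ : (fun x => _) = (fun x : borel G => \int[mu]_y (EFin \o F)^\+ (x, y) -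
    \int[mu]_y (EFin \o F)^\- (x, y))); last first.
  apply/funext => x; rewrite [LHS]integralE.
  by congr (_ - _); apply: eq_integral => y _; rewrite ?funeposE ?funenegE.
apply: emeasurable_funB.
- apply: (measurable_haar_tonelli hG haar _ _ sS) => //.
    exact: measurable_funepos.
  move=> x y; rewrite funeposE /= => h; apply: (FS x y).
  by apply: contraNneq h => ->; rewrite maxxx.
- apply: (measurable_haar_tonelli hG haar _ _ sS) => //.
    exact: measurable_funeneg.
  move=> x y; rewrite funenegE /= => h; apply: (FS x y).
  by apply: contraNneq h => ->; rewrite ?EFinN ?oppr0 ?oppe0 maxxx.
Qed.

Implicit Types f g h : L1 mu.

Let nE f (x : borel G) : \bar R := (complex.Re `|f x|)%:E.

(** The convolution of [|f|] and [|g|], extended-valued because it may be infinite on a null set; it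
    dominates the convolution of [f] and [g]. *)
Definition norm_convolution f g (x : borel G) : \bar R :=
  \int[mu]_y (nE f y * nE g ((y^-1 * x)%g : borel G)).

Let mnE f : measurable_fun [set: borel G] (nE f).
Proof. exact: measurable_int (integrable_normc f). Qed.

Let nE0 f x : 0 <= nE f x. Proof. by rewrite lee_fin Re_normr_ge0. Qed.

Let snE f : sigma_bounded [set x : G | nE f x != 0].
Proof. exact: (integrable_sigma_bounded hG lcG haar (integrable_normc f)). Qed.

Let norm1E f : \int[mu]_x nE f x = (norm1 f)%:E.
Proof.
rewrite /norm1 /Rintegral fineK//.
exact: (integrable_fin_num measurableT (integrable_normc f)).
Qed.

Lemma measurable_norm_convolution f g :
  measurable_fun [set: borel G] (norm_convolution f g).
Proof. exact: measurable_ge0_convolution. Qed.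

Lemma norm_convolution_ge0 f g x : 0 <= norm_convolution f g x.
Proof. by apply: integral_ge0 => y _; rewrite mule_ge0. Qed.

Lemma integral_norm_convolution f g :
  \int[mu]_x norm_convolution f g x = (norm1 f * norm1 g)%:E.
Proof. by rewrite integral_ge0_convolution// !norm1E EFinM. Qed.

Lemma integrable_norm_convolution f g : mu.-integrable setT (norm_convolution f g).
Proof.
apply/integrableP; split; first exact: measurable_norm_convolution.
under eq_integral do rewrite gee0_abs ?norm_convolution_ge0//.
by rewrite integral_norm_convolution ltry.
Qed.

Lemma measurable_Re_L1 f : measurable_fun [set: borel G] (fun x : borel G => complex.Re (f x)).
Proof.
by apply/measurable_EFinP; have [+ _] := cintegrableP f; exact: measurable_int.
Qed.

Lemma measurable_Im_L1 f : measurable_fun [set: borel G] (fun x : borel G => complex.Im (f x)).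
Proof.
by apply/measurable_EFinP; have [_ +] := cintegrableP f; exact: measurable_int.
Qed.

Let cv f g (z : G * G) := (f z.2 * g (z.2^-1 * z.1)%g)%R.

Let measurable_Re_cv f g :
  measurable_fun [set: borelT (G * G)%type] (fun z => complex.Re (cv f g z)).
Proof.
under eq_fun do rewrite Re_M.
apply: measurable_funB; apply: measurable_funM.
- exact: (measurableT_comp (measurable_Re_L1 f) measurable_sndG).
- exact: (measurableT_comp (measurable_Re_L1 g) measurable_divl).
- exact: (measurableT_comp (measurable_Im_L1 f) measurable_sndG).
- exact: (measurableT_comp (measurable_Im_L1 g) measurable_divl).
Qed.

Let measurable_Im_cv f g :
  measurable_fun [set: borelT (G * G)%type] (fun z => complex.Im (cv f g z)).
Proof.
under eq_fun do rewrite Im_M.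
apply: measurable_funD; apply: measurable_funM.
- exact: (measurableT_comp (measurable_Re_L1 f) measurable_sndG).
- exact: (measurableT_comp (measurable_Im_L1 g) measurable_divl).
- exact: (measurableT_comp (measurable_Im_L1 f) measurable_sndG).
- exact: (measurableT_comp (measurable_Re_L1 g) measurable_divl).
Qed.

Let cv_neq0 f g x y : cv f g (x, y) != 0%R -> nE f y != 0.
Proof.
apply: contraNneq => /eqP; rewrite eqe => /eqP/Re_normr_eq0 fy.
by rewrite /cv /= fy mul0r.
Qed.

Let normr_Rintegral_le (k : borel G -> R) (w : borel G -> \bar R) :
  measurable_fun [set: borel G] k -> (forall y, `|k y|%:E <= w y) ->
  measurable_fun [set: borel G] w ->
  `|(\int[mu]_y k y)%R|%:E <= \int[mu]_y w y.
Proof.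
move=> mk kw mw; apply: (@le_trans _ _ `|\int[mu]_y (k y)%:E|).
  by rewrite /Rintegral; case: (\int[mu]_y _) => [r| |] //=; rewrite normr0 leey.
apply: le_trans (le_abse_integral _ measurableT _) _.
  exact/measurable_EFinP.
apply: ge0_le_integral => //; last by move=> y _; exact: kw.
by apply: measurableT_comp => //; exact/measurable_EFinP.
Qed.

Let cv_bound f g x (y : borel G) :
  (complex.Re `|cv f g (x, y)|)%:E = nE f y * nE g ((y^-1 * x)%g : borel G).
Proof. by rewrite -EFinM -Re_normrM. Qed.

Let measurable_cv_bound f g x : measurable_fun [set: borel G]
  (fun y : borel G => nE f y * nE g ((y^-1 * x)%g : borel G)).
Proof.
apply: emeasurable_funM => //; apply: (measurableT_comp (mnE g)).
exact: (measurable_pairl x measurable_divl).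
Qed.

Lemma Re_convolution_le f g x :
  `|complex.Re (cintegral mu (fun y => (f y * g (y^-1 * x)%g)%R))|%:E <=
  norm_convolution f g x.
Proof.
apply: normr_Rintegral_le.
- exact: (measurable_pairl x (measurable_Re_cv f g)).
- by move=> y; rewrite -cv_bound lee_fin normr_Re_le.
- exact: measurable_cv_bound.
Qed.

Lemma Im_convolution_le f g x :
  `|complex.Im (cintegral mu (fun y => (f y * g (y^-1 * x)%g)%R))|%:E <=
  norm_convolution f g x.
Proof.
apply: normr_Rintegral_le.
- exact: (measurable_pairl x (measurable_Im_cv f g)).
- by move=> y; rewrite -cv_bound lee_fin normr_Im_le.
- exact: measurable_cv_bound.
Qed.

(** Domination by [norm_convolution] gives integrability, so [insubd] does not fall back to [0]. The
    formula holds at every [x] because [cintegral] is total; linearity of the convolution will hold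
    only almost everywhere. *)
Lemma convolutionE f g x :
  convolution f g x = cintegral mu (fun y => (f y * g (y^-1 * x)%g)%R).
Proof.
rewrite /convolution; set w := (X in insubd _ X).
suff wP : w \in L1_pred mu.
  exact: (congr1 (fun p : G -> R[i] => p x) (insubdK (0%R : L1 mu) wP)).
apply/asboolP; split.
- apply: (le_integrable measurableT _ _ (integrable_norm_convolution f g)).
    apply/measurable_EFinP.
    apply: (measurable_Rintegral_pair (measurable_Re_cv f g) (snE f)) => x' y h.
    by apply: (cv_neq0 (g := g) (x := x')); apply: contraNneq h => ->.
  move=> x' _; rewrite [leRHS]gee0_abs ?norm_convolution_ge0//.
  exact: Re_convolution_le.
- apply: (le_integrable measurableT _ _ (integrable_norm_convolution f g)).
    apply/measurable_EFinP.
    apply: (measurable_Rintegral_pair (measurable_Im_cv f g) (snE f)) => x' y h.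
    by apply: (cv_neq0 (g := g) (x := x')); apply: contraNneq h => ->.
  move=> x' _; rewrite [leRHS]gee0_abs ?norm_convolution_ge0//.
  exact: Im_convolution_le.
Qed.

(** The constant [2] comes from bounding a modulus by the sum of the absolute values of the real and
    imaginary parts. What follows uses only boundedness of the actions, not the sharp constant. *)
Lemma norm1_convolution f g : (norm1 (convolution f g) <= 2 * (norm1 f * norm1 g))%R.
Proof.
rewrite -lee_fin -norm1E EFinM -integral_norm_convolution.
rewrite -ge0_integralZl//; last 2 first.
- exact: measurable_norm_convolution.
- by move=> x _; exact: norm_convolution_ge0.
apply: ge0_le_integral => //.
  by apply: measurable_funeM; exact: measurable_norm_convolution.
move=> x _; rewrite /nE convolutionE.
apply: (@le_trans _ _ (norm_convolution f g x + norm_convolution f g x)).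
  apply: le_trans (leeD (Re_convolution_le f g x) (Im_convolution_le f g x)).
  by rewrite -EFinD lee_fin Re_normr_le.
by rewrite mule_natl mule2n.
Qed.

Lemma ae_norm_convolution_lty f g :
  {ae mu, forall x, norm_convolution f g x < +oo}.
Proof.
apply: filterS (integrable_ae measurableT (integrable_norm_convolution f g)).
by move=> x /(_ I); rewrite ge0_fin_numE// norm_convolution_ge0.
Qed.

Lemma cintegrable_convolution f g x : norm_convolution f g x < +oo ->
  cintegrable mu (fun y => (f y * g (y^-1 * x)%g)%R).
Proof.
move=> fgx.
have iw : mu.-integrable setT (fun y : borel G => nE f y * nE g ((y^-1 * x)%g : borel G)).
  apply/integrableP; split; first exact: measurable_cv_bound.
  by under eq_integral do rewrite gee0_abs ?mule_ge0//.
split; apply: (le_integrable measurableT _ _ iw).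
- apply/measurable_EFinP; exact: (measurable_pairl x (measurable_Re_cv f g)).
- move=> y _; rewrite [leRHS]gee0_abs ?mule_ge0// -cv_bound lee_fin.
  exact: normr_Re_le.
- apply/measurable_EFinP; exact: (measurable_pairl x (measurable_Im_cv f g)).
- move=> y _; rewrite [leRHS]gee0_abs ?mule_ge0// -cv_bound lee_fin.
  exact: normr_Im_le.
Qed.

Lemma cintegral_linear (a : R[i]) (p q : G -> R[i]) :
  cintegrable mu p -> cintegrable mu q ->
  cintegral mu (fun y => (a * p y + q y)%R) =
  (a * cintegral mu p + cintegral mu q)%R.
Proof.
move=> /asboolP ip /asboolP iq.
exact: (cintegral_scalar a (MkL1 ip) (MkL1 iq)).
Qed.

Lemma ae_convolution_linearl (a : R[i]) f g h :
  {ae mu, forall x : borel G, convolution (a *: f + g)%R h x =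
    (a *: convolution f h + convolution g h)%R x}.
Proof.
apply: filterS2 (ae_norm_convolution_lty f h) (ae_norm_convolution_lty g h) => x.
move=> /cintegrable_convolution fx /cintegrable_convolution gx.
rewrite convolutionE -[RHS]/(a * convolution f h x + convolution g h x)%R.
rewrite !convolutionE -cintegral_linear//; congr (cintegral mu _).
apply/funext => y; rewrite mulrA -mulrDl.
by rewrite -[L1_fun (_ + _)%R y]/(a * f y + g y)%R.
Qed.

Lemma ae_convolution_linearr (a : R[i]) f g h :
  {ae mu, forall x : borel G, convolution h (a *: f + g)%R x =
    (a *: convolution h f + convolution h g)%R x}.
Proof.
apply: filterS2 (ae_norm_convolution_lty h f) (ae_norm_convolution_lty h g) => x.
move=> /cintegrable_convolution fx /cintegrable_convolution gx.
rewrite convolutionE -[RHS]/(a * convolution h f x + convolution h g x)%R.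
rewrite !convolutionE -cintegral_linear//; congr (cintegral mu _).
apply/funext => y; rewrite mulrCA -mulrDr.
by rewrite -[L1_fun (_ + _)%R _]/(a * f (y^-1 * x)%g + g (y^-1 * x)%g)%R.
Qed.

Lemma norm1_ae_eq0 f : {ae mu, forall x : borel G, f x = 0%R} -> norm1 f = 0%R.
Proof.
move=> f0; apply/eqP; rewrite -eqe -norm1E; apply/eqP.
rewrite (ge0_ae_eq_integral _ (g := cst 0)) ?integral0//.
by apply: filterS f0 => x /= fx _; rewrite /nE fx normr0.
Qed.

Lemma LinftyP (T : Linfty mu) : bounded_functional T.
Proof. by case: T => T TP; exact/asboolP. Qed.

Lemma Linfty_linear (T : Linfty mu) (a : R[i]) f g :
  T (a *: f + g)%R = (a * T f + T g)%R.
Proof. by have [+ _] := LinftyP T; apply. Qed.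

Lemma Linfty_ae_eq (T : Linfty mu) f g :
  {ae mu, forall x : borel G, f x = g x} -> T f = T g.
Proof.
move=> fg; have [Tl [c Tc]] := LinftyP T.
have := Tl (-1)%R g f; have := Tc (-1 *: g + f)%R.
rewrite (norm1_ae_eq0 (f := (-1 *: g + f)%R)).
  rewrite mulr0 => /= h e; move: h; rewrite e normr_le0 mulN1r addrC subr_eq0.
  by move/eqP.
apply: filterS fg => x fgx.
by rewrite -[LHS]/(-1 * g x + f x)%R fgx mulN1r addNr.
Qed.

(** Linearity comes from the almost-everywhere linearity of convolution and boundedness from its
    norm estimate, so the default value of [insubd] is not taken. *)
Lemma lmodule_actE f (T : Linfty mu) g : lmodule_act f T g = T (convolution f g).
Proof.
rewrite /lmodule_act; set w := (X in insubd _ X).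
suff wP : w \in @Linfty_pred R G mu.
  exact: (congr1 (fun S : L1 mu -> R[i] => S g) (insubdK (0%R : Linfty mu) wP)).
apply/asboolP; split.
  move=> a p q; rewrite /w -Linfty_linear.
  by apply: Linfty_ae_eq; exact: ae_convolution_linearr.
have [_ [c Tc]] := LinftyP T; exists (`|c| * (2 * norm1 f))%R => p.
apply: le_trans (Tc _) _; rewrite lecR.
apply: (@le_trans _ _ (`|c| * norm1 (convolution f p))%R).
  by rewrite ler_wpM2r ?norm1_ge0// ler_norm.
by rewrite -mulrA ler_wpM2l// -mulrA norm1_convolution.
Qed.

Lemma rmodule_actE f (T : Linfty mu) g : rmodule_act T f g = T (convolution g f).
Proof.
rewrite /rmodule_act; set w := (X in insubd _ X).
suff wP : w \in @Linfty_pred R G mu.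
  exact: (congr1 (fun S : L1 mu -> R[i] => S g) (insubdK (0%R : Linfty mu) wP)).
apply/asboolP; split.
  move=> a p q; rewrite /w -Linfty_linear.
  by apply: Linfty_ae_eq; exact: ae_convolution_linearl.
have [_ [c Tc]] := LinftyP T; exists (`|c| * (2 * norm1 f))%R => p.
apply: le_trans (Tc _) _; rewrite lecR.
apply: (@le_trans _ _ (`|c| * norm1 (convolution p f))%R).
  by rewrite ler_wpM2r ?norm1_ge0// ler_norm.
by rewrite -mulrA ler_wpM2l// -mulrA [(norm1 f * _)%R]mulrC norm1_convolution.
Qed.

End convolution.

(** * Real integrable functions as elements of [L1] *)

Section real_L1.
Context {R : realType} {G : topologicalGroupType}.
Variable mu : {measure set (borel G) -> \bar R}.
Hypotheses (hG : hausdorff_space G) (lcG : locally_compact [set: G])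
  (haar : left_haar_measure mu).
Implicit Types (f g : L1 mu) (S T : Linfty mu) (u v : borel G -> R).

Local Notation integrable u := (mu.-integrable setT (EFin \o u)).

Definition realL1 (u : borel G -> R) : L1 mu := insubd 0 (fun x : G => (u x)%:C).

Lemma realL1E u x : integrable u -> realL1 u x = (u x)%:C.
Proof.
move=> iu; rewrite /realL1; set w := (X in insubd _ X).
suff wP : w \in L1_pred mu.
  exact: (congr1 (fun p : G -> R[i] => p x) (insubdK (0%R : L1 mu) wP)).
apply/asboolP; split => //=.
by rewrite (_ : (fun _ => _) = cst 0%E)//; exact: integrable0.
Qed.

Lemma realL1_conv u v x : integrable u -> integrable v ->
  convolution (realL1 u) (realL1 v) x =
  (\int[mu]_y (u y * v ((y^-1 * x)%g : borel G)))%:C.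
Proof.
move=> iu iv; rewrite (convolutionE hG lcG haar) /cintegral.
have e y : realL1 u y * realL1 v (y^-1 * x)%g =
    (u y * v ((y^-1 * x)%g : borel G))%:C.
  by rewrite !realL1E// rmorphM.
congr (_ +i* _); first by apply: eq_Rintegral => y _; rewrite e.
transitivity (\int[mu]_y (cst 0 y : R)).
  by apply: eq_Rintegral => y _; rewrite e.
by rewrite /Rintegral integral0.
Qed.

Lemma norm1_realL1 u : integrable u -> (forall x, 0 <= u x) ->
  norm1 (realL1 u) = \int[mu]_x u x.
Proof.
move=> iu u0; apply: eq_Rintegral => x _.
by rewrite realL1E// normc_def /= expr0n addr0 sqrtr_sqr ger0_norm.
Qed.

Lemma cintegral_realL1 u : integrable u ->
  cintegral mu (realL1 u) = (\int[mu]_x u x)%:C.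
Proof.
move=> iu; congr (_ +i* _); first by apply: eq_Rintegral => y _; rewrite realL1E.
transitivity (\int[mu]_y (cst 0 y : R)).
  by apply: eq_Rintegral => y _; rewrite realL1E.
by rewrite /Rintegral integral0.
Qed.

Lemma nonneg_realL1 u : integrable u -> (forall x, 0 <= u x) ->
  nonneg_L1 (realL1 u).
Proof. by move=> iu u0; apply: aeW => x; rewrite realL1E// ler0c. Qed.

Lemma integrable_Re_normr f : integrable (fun x => complex.Re `|f x|).
Proof. exact: integrable_normc. Qed.

Lemma nonneg_L1_ae f : nonneg_L1 f -> {ae mu, forall x : borel G,
  f x = realL1 (fun x => complex.Re `|f x|) x}.
Proof.
apply: filterS => x fx; rewrite realL1E; last exact: integrable_Re_normr.
by rewrite [in RHS]ger0_norm//; move: fx; case: (L1_fun f x) => a b;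
  rewrite lecE /= => /andP[/eqP -> _].
Qed.

(** A nonnegative element agrees almost everywhere with its modulus, so functions that are real and
    nonnegative at every point suffice as tests. *)
Lemma nonneg_LinftyP T :
  (forall u, integrable u -> (forall x, 0 <= u x) -> 0 <= T (realL1 u)) ->
  nonneg_Linfty T.
Proof.
move=> T0 f /nonneg_L1_ae /(Linfty_ae_eq T) ->.
by apply: T0 => [|x]; [exact: integrable_Re_normr|exact: Re_normr_ge0].
Qed.

Lemma Linfty0 T : T 0 = 0.
Proof.
have := Linfty_linear T 1 0 0; rewrite scale1r addr0 mul1r => /eqP.
by rewrite -subr_eq0 opprD addrA subrr sub0r oppr_eq0 => /eqP.
Qed.

Lemma LinftyZ T a f : T (a *: f) = a * T f.
Proof. by have := Linfty_linear T a f 0; rewrite addr0 Linfty0 addr0. Qed.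

Lemma LinftyD T f g : T (f + g) = T f + T g.
Proof. by have := Linfty_linear T 1 f g; rewrite scale1r mul1r. Qed.

Lemma LinftyB T f g : T (f - g) = T f - T g.
Proof. by rewrite LinftyD -scaleN1r LinftyZ mulN1r. Qed.

Lemma Linfty_sum T n (F : 'I_n -> L1 mu) : T (\sum_j F j) = \sum_j T (F j).
Proof.
elim: n F => [|n IH] F; first by rewrite !big_ord0 Linfty0.
by rewrite !big_ord_recr /= LinftyD IH.
Qed.

Lemma L1_sum n (F : 'I_n -> L1 mu) x : (\sum_j F j) x = \sum_j F j x.
Proof.
elim: n F => [|n IH] F; first by rewrite !big_ord0.
by rewrite !big_ord_recr /= -IH.
Qed.

Lemma Linfty_sumE n (F : 'I_n -> Linfty mu) f : (\sum_j F j) f = \sum_j F j f.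
Proof.
elim: n F => [|n IH] F; first by rewrite !big_ord0.
by rewrite !big_ord_recr /= -IH.
Qed.

Lemma Linfty_eqP S T : (forall f, S f = T f) -> S = T.
Proof. by move=> ST; apply/val_inj/funext. Qed.

Lemma Linfty_eq_real S T :
  (forall u, integrable u -> (forall x, 0 <= u x) ->
    S (realL1 u) = T (realL1 u)) -> S = T.
Proof.
move=> ST; apply: Linfty_eqP => f; have [fr fi] := cintegrableP f.
pose p1 : borel G -> R := (fun x : borel G => complex.Re (f x))^\+%R.
pose p2 : borel G -> R := (fun x : borel G => complex.Re (f x))^\-%R.
pose p3 : borel G -> R := (fun x : borel G => complex.Im (f x))^\+%R.
pose p4 : borel G -> R := (fun x : borel G => complex.Im (f x))^\-%R.
have i1 : integrable p1 by exact: (integrable_funrpos measurableT fr).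
have i2 : integrable p2 by exact: (integrable_funrneg measurableT fr).
have i3 : integrable p3 by exact: (integrable_funrpos measurableT fi).
have i4 : integrable p4 by exact: (integrable_funrneg measurableT fi).
have -> : f = (realL1 p1 - realL1 p2) + 'i *: (realL1 p3 - realL1 p4).
  apply/val_inj/funext => x.
  transitivity ((p1 x)%:C - (p2 x)%:C + 'i * ((p3 x)%:C - (p4 x)%:C)); last first.
    by rewrite -!realL1E.
  rewrite -!rmorphB /=.
  have -> : p1 x - p2 x = complex.Re (f x).
    exact: (congr1 (fun p => p x) (funrposBneg (fun x : borel G => complex.Re (f x)))).
  have -> : p3 x - p4 x = complex.Im (f x).
    exact: (congr1 (fun p => p x) (funrposBneg (fun x : borel G => complex.Im (f x)))).
  by rewrite -complexE.
have p0 := funrpos_ge0; have n0 := funrneg_ge0.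
by rewrite !(LinftyB, LinftyD, LinftyZ) !ST// => x; rewrite ?p0 ?n0.
Qed.

(** For nonnegative integrable [u] and [v], [fine] alters the integral only on the null set where it
    is [+oo], replacing it by [0] there. *)
Definition real_convolution u v (x : borel G) : R :=
  fine (\int[mu]_y ((u y)%:E * (v ((y^-1 * x)%g : borel G))%:E))%E.

Lemma real_convolutionP u v : integrable u -> integrable v ->
  (forall x, 0 <= u x) -> (forall x, 0 <= v x) ->
  [/\ integrable (real_convolution u v),
      forall x, 0 <= real_convolution u v x,
      convolution (realL1 u) (realL1 v) = realL1 (real_convolution u v),
      \int[mu]_x real_convolution u v x =
        (\int[mu]_x u x) * (\int[mu]_x v x) &
      {ae mu, forall x, (real_convolution u v x)%:E =
        (\int[mu]_y ((u y)%:E * (v ((y^-1 * x)%g : borel G))%:E))%E}].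
Proof.
move=> iu iv u0 v0.
have mE (w : borel G -> R) : integrable w -> measurable_fun [set: borel G] w.
  by move=> iw; apply/measurable_EFinP; exact: measurable_int iw.
have iw (w : borel G -> R) : integrable w ->
    (\int[mu]_x (w x)%:E = (\int[mu]_x w x)%:E)%E.
  by move=> iw; rewrite /Rintegral fineK//; exact: (integrable_fin_num measurableT iw).
pose W (x : borel G) := (\int[mu]_y ((u y)%:E * (v ((y^-1 * x)%g : borel G))%:E))%E.
have W0 x : (0 <= W x)%E.
  by apply: integral_ge0 => y _; rewrite mule_ge0 ?lee_fin.
have su : sigma_bounded [set x : G | (u x)%:E != 0%E].
  exact: (integrable_sigma_bounded hG lcG haar iu).
have sv : sigma_bounded [set x : G | (v x)%:E != 0%E].
  exact: (integrable_sigma_bounded hG lcG haar iv).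
have mu' : measurable_fun [set: borel G] (EFin \o u).
  by apply/measurable_EFinP; exact: mE.
have mv' : measurable_fun [set: borel G] (EFin \o v).
  by apply/measurable_EFinP; exact: mE.
have u0' x : (0 <= (EFin \o u) x)%E by rewrite lee_fin.
have v0' x : (0 <= (EFin \o v) x)%E by rewrite lee_fin.
have mW : measurable_fun [set: borel G] W.
  exact: (measurable_ge0_convolution hG haar mu' mv' u0' v0' su).
have IW : (\int[mu]_x W x = ((\int[mu]_x u x) * (\int[mu]_x v x))%:E)%E.
  rewrite (integral_ge0_convolution hG haar mu' mv' u0' v0' su sv).
  by rewrite [X in (X * _)%E]iw// [X in (_ * X)%E]iw// EFinM.
have iW : mu.-integrable setT W.
  apply/integrableP; split => //.
  by under eq_integral do rewrite gee0_abs//; rewrite IW ltry.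
have aeW : {ae mu, forall x, (real_convolution u v x)%:E = W x}.
  apply: filterS (integrable_ae measurableT iW) => x /(_ I) h.
  by rewrite /real_convolution fineK.
have w0 x : 0 <= real_convolution u v x by apply: fine_ge0; exact: W0.
have mw : measurable_fun [set: borel G] (EFin \o real_convolution u v).
  by apply/measurable_EFinP; exact: (measurableT_comp (fine_measurable (D := setT) measurableT) mW).
have Iw : (\int[mu]_x (real_convolution u v x)%:E = \int[mu]_x W x)%E.
  apply: ge0_ae_eq_integral => //; first by move=> x _; rewrite lee_fin.
  by apply: filterS aeW => x h _.
have iw' : integrable (real_convolution u v).
  apply/integrableP; split => //.
  by under eq_integral do rewrite gee0_abs ?lee_fin//; rewrite Iw IW ltry.
split => //.
- apply/val_inj/funext => x.
  rewrite -[LHS]/(convolution (realL1 u) (realL1 v) x) -[RHS]/(realL1 _ x).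
  by rewrite realL1E// realL1_conv.
- by rewrite /Rintegral Iw IW.
Qed.

Lemma cintegral_conv u v : integrable u -> integrable v ->
  (forall x, 0 <= u x) -> (forall x, 0 <= v x) ->
  cintegral mu (convolution (realL1 u) (realL1 v)) =
  ((\int[mu]_x u x) * (\int[mu]_x v x))%:C.
Proof.
move=> iu iv u0 v0; have [iw _ -> Iw _] := real_convolutionP iu iv u0 v0.
by rewrite cintegral_realL1// Iw.
Qed.

Lemma rmodule_act_one v : integrable v -> (forall x, 0 <= v x) ->
  rmodule_act (one_Linfty mu) (realL1 v) = (\int[mu]_x v x)%:C *: one_Linfty mu.
Proof.
move=> iv v0; apply: Linfty_eq_real => u iu u0.
rewrite (rmodule_actE hG lcG haar) -[LHS]/(cintegral mu _) cintegral_conv//.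
rewrite -[RHS]/(_ * cintegral mu (realL1 u)) cintegral_realL1//.
by rewrite mulrC rmorphM.
Qed.

Lemma rmodule_act_linear f a S T :
  rmodule_act (a *: S + T) f = a *: rmodule_act S f + rmodule_act T f.
Proof.
apply: Linfty_eqP => g.
rewrite (rmodule_actE hG lcG haar).
rewrite -[RHS]/(a * rmodule_act S f g + rmodule_act T f g).
by rewrite !(rmodule_actE hG lcG haar).
Qed.

Lemma lmodule_act_scale a f T : lmodule_act (a *: f) T = a *: lmodule_act f T.
Proof.
apply: Linfty_eqP => g.
rewrite (lmodule_actE hG lcG haar) -[RHS]/(a * lmodule_act f T g).
rewrite (lmodule_actE hG lcG haar) -LinftyZ; apply: Linfty_ae_eq.
(* Homogeneity is read off additivity, by writing [a *: f] as [(a - 1) *: f + f]. *)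
apply: filterS (ae_convolution_linearl hG lcG haar (a - 1) f f g) => x.
have -> : (a - 1) *: f + f = a *: f by rewrite scalerBl scale1r subrK.
have -> // : (a - 1) *: convolution f g + convolution f g = a *: convolution f g.
by rewrite scalerBl scale1r subrK.
Qed.

End real_L1.

(** * Means *)

Section means.
Context {R : realType} {G : topologicalGroupType}.
Variable mu : {measure set (borel G) -> \bar R}.
Hypotheses (hG : hausdorff_space G) (lcG : locally_compact [set: G])
  (haar : left_haar_measure mu).
Implicit Types (f g : L1 mu) (S T : Linfty mu) (u v q : borel G -> R).
Variable m : {scalar Linfty mu}.

Local Notation integrable u := (mu.-integrable setT (EFin \o u)).

Lemma meanD S T : m (S + T) = m S + m T. Proof. exact: linearD. Qed.

Lemma meanZ a T : m (a *: T) = a * m T. Proof. exact: linearZ. Qed.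

Lemma meanB S T : m (S - T) = m S - m T. Proof. exact: linearB. Qed.

Lemma mean_le S T : is_mean m -> nonneg_Linfty (T - S) -> m S <= m T.
Proof. by move=> [m0 _] /m0; rewrite meanB subr_ge0. Qed.

(** Invariance is assumed for densities only; dividing [u] by its integral makes it one. *)
Lemma tli_realL1 u T : top_left_invariant m -> integrable u ->
  (forall x, 0 <= u x) -> 0 < \int[mu]_x u x ->
  m (lmodule_act (realL1 mu u) T) = (\int[mu]_x u x)%:C * m T.
Proof.
move=> tli iu u0 Iu; set c := (X in X%:C); pose u' x := c^-1 * u x.
have iu' : integrable u' by exact: (integrableZl measurableT c^-1 iu).
have u'0 x : 0 <= u' x by rewrite mulr_ge0// invr_ge0 ltW.
have -> : realL1 mu u = c%:C *: realL1 mu u'.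
  apply/val_inj/funext => x.
  rewrite -[RHS]/(c%:C * realL1 mu u' x) -[LHS]/(realL1 mu u x) !realL1E//.
  by rewrite -rmorphM /u' mulVKf// gt_eqF.
rewrite (lmodule_act_scale hG lcG haar) meanZ tli//; split.
  exact: nonneg_realL1.
by rewrite norm1_realL1// RintegralZl// mulVf// gt_eqF.
Qed.

Definition mulL1 q f : L1 mu := insubd 0 (fun x : G => (q x)%:C * f x).

(** The product [q T], defined by duality with pointwise multiplication on [L1]; the next section
    shows it to be this functional for bounded measurable [q]. *)
Definition mul_Linfty q T : Linfty mu := insubd 0 (fun f : L1 mu => T (mulL1 q f)).

Section multiplication.
Variables (q : borel G -> R) (M : R).
Hypotheses (mq : measurable_fun [set: borel G] q) (qM : forall x, `|q x| <= M).

Lemma mulL1E f x : mulL1 q f x = (q x)%:C * f x.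
Proof.
rewrite /mulL1; set w := (X in insubd _ X).
suff wP : w \in L1_pred mu.
  exact: (congr1 (fun p : G -> R[i] => p x) (insubdK (0%R : L1 mu) wP)).
have M0 : 0 <= M by exact: le_trans (normr_ge0 (q x)) (qM x).
have bq (p : borel G -> R) : integrable p -> integrable (fun x => q x * p x).
  move=> ip; apply: (le_integrable measurableT _ _ (integrableZl measurableT M ip)).
    apply/measurable_EFinP; apply: measurable_funM => //.
    by apply/measurable_EFinP; exact: measurable_int ip.
  by move=> y _; rewrite /= lee_fin !normrM ler_wpM2r// (le_trans (qM y))// ler_norm.
have [fr fi] := cintegrableP f.
have {}fr := bq _ fr; have {}fi := bq _ fi.
apply/asboolP; split.
- apply: eq_integrable fr => // y _ /=; rewrite /w; case: (L1_fun f y) => a b /=.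
  by rewrite mul0r subr0.
- apply: eq_integrable fi => // y _ /=; rewrite /w; case: (L1_fun f y) => a b /=.
  by rewrite mul0r addr0.
Qed.

Lemma norm1_mulL1 f : norm1 (mulL1 q f) <= M * norm1 f.
Proof.
rewrite -RintegralZl//; last exact: integrable_normc.
apply: le_Rintegral => //; first exact: integrable_normc.
  exact: (integrableZl measurableT M (integrable_normc f)).
move=> x _; rewrite mulL1E Re_normrM ler_wpM2r ?Re_normr_ge0//.
by rewrite normc_def /= expr0n addr0 sqrtr_sqr.
Qed.

Lemma mul_LinftyE T f : mul_Linfty q T f = T (mulL1 q f).
Proof.
rewrite /mul_Linfty; set w := (X in insubd _ X).
suff wP : w \in @Linfty_pred R G mu.
  exact: (congr1 (fun S : L1 mu -> R[i] => S f) (insubdK (0%R : Linfty mu) wP)).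
apply/asboolP; split.
  move=> a g h; rewrite /w -Linfty_linear; congr (T _).
  apply/val_inj/funext => x.
  rewrite -[RHS]/(a * mulL1 q g x + mulL1 q h x) -[LHS]/(mulL1 q (a *: g + h) x).
  by rewrite !mulL1E -[L1_fun (_ + _) x]/(a * g x + h x) mulrDr mulrCA.
have [_ [c Tc]] := LinftyP T; exists (`|c| * M) => g.
apply: le_trans (Tc _) _; rewrite lecR.
apply: (@le_trans _ _ (`|c| * norm1 (mulL1 q g))).
  by rewrite ler_wpM2r ?norm1_ge0// ler_norm.
by rewrite -mulrA ler_wpM2l// norm1_mulL1.
Qed.

End multiplication.

Definition conjL1 f : L1 mu := insubd 0 (fun x : G => (f x)^*).

Lemma conjL1E f x : conjL1 f x = (f x)^*.
Proof.
rewrite /conjL1; set w := (X in insubd _ X).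
suff wP : w \in L1_pred mu.
  exact: (congr1 (fun p : G -> R[i] => p x) (insubdK (0%R : L1 mu) wP)).
have [fr fi] := cintegrableP f; apply/asboolP; split.
- by apply: eq_integrable fr => // y _ /=; rewrite /w; case: (L1_fun f y).
- apply: eq_integrable (integrableZl measurableT (-1) fi) => // y _ /=.
  by rewrite /w; case: (L1_fun f y) => a b /=; rewrite -EFinM mulN1r.
Qed.

(** Conjugating both the argument and the value keeps the functional complex linear, and on real
    functions it amounts to conjugating the value. *)
Definition conj_Linfty T : Linfty mu := insubd 0 (fun f : L1 mu => (T (conjL1 f))^*).

Lemma conj_LinftyE T f : conj_Linfty T f = (T (conjL1 f))^*.
Proof.
rewrite /conj_Linfty; set w := (X in insubd _ X).
suff wP : w \in @Linfty_pred R G mu.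
  exact: (congr1 (fun S : L1 mu -> R[i] => S f) (insubdK (0%R : Linfty mu) wP)).
apply/asboolP; split.
  move=> a g h; rewrite /w.
  have -> : conjL1 (a *: g + h) = a^* *: conjL1 g + conjL1 h.
    apply/val_inj/funext => x.
    rewrite -[RHS]/(a^* * conjL1 g x + conjL1 h x) -[LHS]/(conjL1 (a *: g + h) x).
    by rewrite !conjL1E -[L1_fun (_ + _) x]/(a * g x + h x) rmorphD rmorphM.
  by rewrite Linfty_linear rmorphD rmorphM /= conjcK.
have [_ [c Tc]] := LinftyP T; exists c => g.
have -> : norm1 g = norm1 (conjL1 g).
  apply: eq_Rintegral => x _; rewrite conjL1E !normc_def.
  by case: (L1_fun g x) => a b /=; rewrite sqrrN.
by rewrite -[`|w g|]/(`|(T (conjL1 g))^*|) norm_conjC; exact: Tc.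
Qed.

Lemma conj_Linfty_real T u : integrable u ->
  conj_Linfty T (realL1 mu u) = (T (realL1 mu u))^*.
Proof.
move=> iu; rewrite conj_LinftyE; congr (T _)^*.
apply/val_inj/funext => x; rewrite -[LHS]/(conjL1 (realL1 mu u) x) conjL1E.
by rewrite realL1E// -[RHS]/(realL1 mu u x) realL1E//= oppr0.
Qed.

(** [S1] and [S2] are the real and imaginary parts of [T], each shifted by [c] times the constant
    [1]; the shift makes them nonnegative because [c] is a norm bound for [T], and the last term
    undoes it. *)
Lemma Linfty_nonneg_decomp T : exists S1 S2 a,
  [/\ nonneg_Linfty S1, nonneg_Linfty S2 &
      T = S1 + 'i *: S2 + a *: one_Linfty mu].
Proof.
have [_ [c Tc]] := LinftyP T.
pose S1 := (2^-1)%:C *: (T + conj_Linfty T) + c%:C *: one_Linfty mu.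
pose S2 := ((2^-1)%:C * - 'i) *: (T - conj_Linfty T) + c%:C *: one_Linfty mu.
have zle u : integrable u -> (forall x, 0 <= u x) ->
    complex.Re `|T (realL1 mu u)| <= c * \int[mu]_x u x.
  move=> iu u0; have := Tc (realL1 mu u); rewrite norm1_realL1//.
  by rewrite normc_def lecR.
exists S1, S2, (- (c%:C + 'i * c%:C)); split.
- apply: nonneg_LinftyP => u iu u0.
  rewrite -[S1 _]/((2^-1)%:C * (T (realL1 mu u) + conj_Linfty T (realL1 mu u)) +
    c%:C * cintegral mu (realL1 mu u)).
  rewrite conj_Linfty_real// cintegral_realL1//.
  have := le_trans (normr_Re_le _) (zle u iu u0).
  case: (Linfty_fun T _) => a b /= ab; rewrite lecE /=; apply/andP; split.
    by apply/eqP; ring.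
  by have := ler_norm (- a); rewrite normrN; lra.
- apply: nonneg_LinftyP => u iu u0.
  rewrite -[S2 _]/((2^-1)%:C * - 'i * (T (realL1 mu u) - conj_Linfty T (realL1 mu u)) +
    c%:C * cintegral mu (realL1 mu u)).
  rewrite conj_Linfty_real// cintegral_realL1//.
  have := le_trans (normr_Im_le _) (zle u iu u0).
  case: (Linfty_fun T _) => a b /= ab; rewrite lecE /=; apply/andP; split.
    by apply/eqP; ring.
  by have := ler_norm (- b); rewrite normrN; lra.
- apply: Linfty_eqP => f.
  rewrite -[RHS]/((2^-1)%:C * (T f + conj_Linfty T f) + c%:C * cintegral mu f +
    'i * ((2^-1)%:C * - 'i * (T f - conj_Linfty T f) + c%:C * cintegral mu f) +
    (- (c%:C + 'i * c%:C)) * cintegral mu f).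
  have ii : 'i * ((2^-1)%:C * - 'i) = (2^-1)%:C :> R[i].
    by apply/eqP; rewrite eq_complex /=; apply/andP; split; apply/eqP; ring.
  have hh : (2^-1)%:C + (2^-1)%:C = 1 :> R[i].
    by rewrite -rmorphD /= (_ : 2^-1 + 2^-1 = 1 :> R)//; field.
  move: (T f) (conj_Linfty T f) (cintegral mu f) => x y z.
  transitivity ((2^-1)%:C * (x + y) + c%:C * z +
    ('i * ((2^-1)%:C * - 'i) * (x - y) + 'i * (c%:C * z)) -
    (c%:C + 'i * c%:C) * z); last by ring.
  by rewrite ii -[LHS]mul1r -hh; ring.
Qed.

End means.

(** * A smoothing kernel and a fine partition of a compact set *)

Section kernel.
Context {R : realType} {G : topologicalGroupType}.
Variable mu : {measure set (borel G) -> \bar R}.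
Hypotheses (hG : hausdorff_space G) (lcG : locally_compact [set: G])
  (haar : left_haar_measure mu).

Local Notation integrable u := (mu.-integrable setT (EFin \o u)).

Definition smoothing_kernel (k : borel G -> R) :=
  [/\ integrable k, exists M, forall x, 0 <= k x <= M, 0 < \int[mu]_x k x,
    (exists2 S : set G, compact S & forall x, k x != 0 -> S x) &
    (forall e, 0 < e -> exists2 W : set G, nbhs (1%g : G) W &
      forall w s, W w -> k (w * s)%g <= k s + e)].

(* The kernel is the convolution of the indicator of a compact neighbourhood
   of the identity with itself. *)
Lemma exists_smoothing_kernel : exists k, smoothing_kernel k.
Proof.
have [A cA nA] := nbhs1_compact hG lcG.
have mA : measurable (A : set (borel G)) by exact: compact_borel.
pose a (x : borel G) : \bar R := (\1_A x)%:E.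
have ma : measurable_fun [set: borel G] a by apply/measurable_EFinP; exact: measurable_indic.
have a0 x : (0 <= a x)%E by rewrite lee_fin.
have aA x : a x != 0%E -> A x.
  by rewrite /a indicE; case: (boolP (x \in A)) => [/set_mem//|_]; rewrite eqxx.
have sa : sigma_bounded [set x : G | a x != 0%E].
  exact: sub_sigma_bounded aA (compact_sigma_bounded cA).
have Ia : (\int[mu]_x a x = mu A)%E by rewrite integral_indic// setIT.
have Aoo : (mu A < +oo)%E by exact: haar_compact.
have A0 : (0 < mu A)%E.
  apply: (@lt_le_trans _ _ (mu (A° : set G))).
    apply: (haar_open_gt0 hG haar); first exact: open_interior.
    by exists 1%g.
  by apply: le_measure; rewrite ?inE//; [apply: open_borel; exact: open_interior|exact: interior_subset].
have fA : mu A \is a fin_num by rewrite ge0_fin_numE.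
pose kE (x : borel G) := (\int[mu]_y (a y * a ((y^-1 * x)%g : borel G)))%E.
have mkE : measurable_fun [set: borel G] kE by exact: (measurable_ge0_convolution hG haar ma ma a0 a0 sa).
have maV x : measurable_fun [set: borel G] (fun y : borel G => a ((y^-1 * x)%g : borel G)).
  by apply: (measurableT_comp ma); exact: (measurable_pairl x (@measurable_divl G)).
have k0 x : (0 <= kE x)%E by apply: integral_ge0 => y _; rewrite mule_ge0.
have a1 x : (a x <= 1)%E by rewrite lee_fin indicE lern1 leq_b1.
have kA x : (kE x <= mu A)%E.
  rewrite -Ia; apply: ge0_le_integral => //.
  - by move=> y _; rewrite mule_ge0.
  - exact: emeasurable_funM.
  - by move=> y _; rewrite -[leRHS]mule1 lee_wpmul2l.
have fk x : kE x \is a fin_num by rewrite ge0_fin_numE// (le_lt_trans (kA x)).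
have Ik : (\int[mu]_x kE x = mu A * mu A)%E.
  by rewrite (integral_ge0_convolution hG haar ma ma a0 a0 sa sa) Ia.
have EFk : EFin \o (fine \o kE) = kE by apply/funext => x /=; rewrite fineK.
exists (fine \o kE); split.
- rewrite EFk; apply/integrableP; split => //.
  by under eq_integral do rewrite gee0_abs//; rewrite Ik ltey_eq fin_numM.
- by exists (fine (mu A)) => x /=; rewrite fine_ge0//= fine_le.
- rewrite /Rintegral; apply: fine_gt0; rewrite -[X in (0 < integral _ _ X < _)%E]/(EFin \o (fine \o kE)).
  by rewrite EFk Ik mule_gt0// ltey_eq fin_numM.
- exists [set (x * y)%g | x in A & y in A]; first exact: compact_mulg.
  move=> x /= kx; apply: contrapT => nx; move/eqP: kx; apply.
  rewrite /kE integral0_eq// => y _; apply/eqP/negP => /negP ay.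
  have ay1 : a y != 0%E by apply: contraNneq ay => ->; rewrite mul0e.
  have ay2 : a ((y^-1 * x)%g : borel G) != 0%E by apply: contraNneq ay => ->; rewrite mule0.
  apply: nx; exists y; first exact: aA.
  by exists (y^-1 * x)%g; [exact: aA|rewrite mulVKg].
- move=> e e0.
  have : (ereal_inf [set mu U | U in [set U : set G | open U /\ A `<=` U]] < mu A + e%:E)%E.
    by rewrite -(haar_outer haar mA) lteDl// lte_fin.
  move=> /ereal_inf_lt[_ [U [oU AU] <-] UA].
  have mU : measurable (U : set (borel G)) by exact: open_borel.
  have nW : \forall w \near (1%g : G), A `<=` [set y | U (w^-1 * y)%g].
    move: cA; rewrite compact_near_coveringP => /(_ _ _ (fun w y => U (w^-1 * y)%g)).
    apply => y /AU Uy.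
    have c : continuous (fun z : G * G => (z.1^-1 * z.2)%g).
      apply: continuousMg; last by move=> z; exact: cvg_snd.
      by apply: continuousVg => z; exact: cvg_fst.
    have /(c (1%g, y))[[P Q] /= [nP nQ] PQ] : nbhs (1%g^-1 * y)%g U.
      by rewrite invg1 mul1g; apply: open_nbhs_nbhs.
    by exists (Q, P) => //= -[y' w] /= [Qy' Pw]; exact: (PQ (w, y')).
  exists [set w | A `<=` [set y | U (w^-1 * y)%g]] => // w s Aw /=.
  rewrite -lee_fin EFinD !fineK//.
  (* After replacing [y] by [w y], the factor [a (w y)] is at most [a y + b y], with [b] the
     indicator of [U] minus [A]: if [w y] lies in [A], then [y] lies in [U]. The added set has
     measure at most [e]. *)
  rewrite {1}/kE -(haar_integral haar w); last 2 first.
  - exact: emeasurable_funM.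
  - by move=> y; rewrite mule_ge0.
  pose b (x : borel G) : \bar R := (\1_(U `\` A) x)%:E.
  have mUA : measurable (U `\` A : set (borel G)) by exact: measurableD.
  have mb : measurable_fun [set: borel G] b by apply/measurable_EFinP; exact: measurable_indic.
  have Ib : (\int[mu]_x b x <= e%:E)%E.
    rewrite integral_indic// setIT measureD//; last first.
      by rewrite (lt_trans UA)// lte_add_pinfty// ltry.
    rewrite (setIidr AU) leeBlDr//.
    by rewrite addeC ltW.
  apply: (@le_trans _ _ (\int[mu]_y (a y * a ((y^-1 * s)%g : borel G) + b y))%E); last first.
    rewrite ge0_integralD//.
    + by rewrite leeD2l.
    + by move=> y _; rewrite mule_ge0.
    + exact: emeasurable_funM.
    + by move=> y _; rewrite lee_fin.
  apply: ge0_le_integral => //.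
  - by move=> y _; rewrite mule_ge0.
  - apply: emeasurable_funM; first by apply: (measurableT_comp ma); exact: mulgl_borel.
    by apply: (measurableT_comp (maV (w * s)%g)); exact: mulgl_borel.
  - by apply: emeasurable_funD => //; exact: emeasurable_funM.
  move=> y _; rewrite invgM -mulgA mulKg.
  apply: (@le_trans _ _ ((a y + b y) * a ((y^-1 * s)%g : borel G))%E).
    apply: lee_wpmul2r => //; rewrite -EFinD lee_fin.
    rewrite !indicE; case: (boolP ((w * y)%g \in A)) => [/set_mem/Aw /=|_]; last by rewrite addr_ge0.
    rewrite mulKg => Uy; case: (boolP (y \in A)) => [_|Ay]; first by rewrite lerDl.
    by rewrite mem_set ?add0r// ; split => // Ay'; move: Ay; rewrite mem_set.
  rewrite ge0_muleDl//; last by rewrite lee_fin.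
  by rewrite leeD2l// -[leRHS]mule1 lee_wpmul2l// lee_fin.
Qed.

(** [J x] is the index of the first centre [c] in [s] with [c x^-1] in the interior of [W], and
    [size s] if there is none. Encoding the partition as one function makes the pieces disjoint, and
    each is a finite Boolean combination of open sets. *)
Lemma compact_partition (C W : set G) : compact C -> nbhs (1%g : G) W ->
  exists (s : seq G) (J : borel G -> nat),
    [/\ forall j, measurable [set x | J x = j],
        forall j, (j < size s)%N -> C (nth 1%g s j) &
        forall x, C x -> (J x < size s)%N /\ W (nth 1%g s (J x) * x^-1)%g].
Proof.
move=> cC nW; pose B (c x : G) := W° (c * x^-1)%g.
have oB c : open [set x | B c x].
  apply: (open_comp (f := fun x => (c * x^-1)%g)); last exact: open_interior.
  move=> x _; apply: (@continuousMg _ _ (fun=> c) (fun x => x^-1%g)).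
    exact: cst_continuous.
  exact: invg_continuous.
pose inB s x := has (fun c => `[<B c x>]) s.
have [s [sC Cs]] : exists s : seq G, (forall c, c \in s -> C c) /\
    (forall x, C x -> inB s x).
  apply: (compact_ind (P := fun A => exists s : seq G,
    (forall c, c \in s -> C c) /\ (forall x, A x -> inB s x)) cC).
  - by exists [::].
  - move=> A1 A2 [s1 [s1C A1s]] [s2 [s2C A2s]]; exists (s1 ++ s2); split.
      by move=> c; rewrite mem_cat => /orP[/s1C|/s2C].
    by move=> x; rewrite /inB has_cat => -[/A1s|/A2s] h; apply/orP; [left|right].
  - by move=> A1 A2 A12 [s [sC As]]; exists s; split => // x /A12/As.
  - move=> x Cx; exists [set y | B x y].
      apply: open_nbhs_nbhs; split => //.
      by rewrite /B /= mulgV.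
    exists [:: x]; split; first by move=> c; rewrite inE => /eqP ->.
    by move=> y Bxy; rewrite /inB /= orbF; apply/asboolP.
exists s, (find^~ s \o (fun x c => `[<B c x>])); split.
- elim: s {sC Cs} => [|c s IH] j /=.
    have [->|j0] := eqVneq j 0%N.
      by rewrite (_ : [set x | _] = setT)//; apply/seteqP; split.
    rewrite (_ : [set x | _] = set0)//; apply/seteqP; split => // x /= /esym/eqP.
    by rewrite (negbTE j0).
  have mB : measurable ([set x | B c x] : set (borel G)) by exact: open_borel.
  case: j => [|j].
    rewrite (_ : [set x | _] = [set x | B c x])//.
    by apply/seteqP; split => x /=; case: asboolP.
  rewrite (_ : [set x | _] = ~` [set x | B c x] `&`
      [set x | (find^~ s \o (fun x c => `[<B c x>])) x = j]).
    by apply: measurableI; [exact: measurableC|exact: IH].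
  apply/seteqP; split => x /=; case: asboolP => //.
    by move=> nB [].
  + by move=> b [].
  + by move=> nB [_ ->].
- by move=> j js; apply: sC; exact: mem_nth.
- move=> x /Cs sx /=; rewrite -has_find; split => //.
  apply: interior_subset.
  by have /asboolP := nth_find 1%g sx.
Qed.

End kernel.

(** * The pointwise convolution inequality *)

Section convolution_lower.
Context {R : realType} {G : topologicalGroupType}.
Variable mu : {measure set (borel G) -> \bar R}.
Hypotheses (hG : hausdorff_space G) (lcG : locally_compact [set: G])
  (haar : left_haar_measure mu).
Variables k u f : borel G -> R.
Hypotheses (mk : measurable_fun [set: borel G] k)
  (mu_ : measurable_fun [set: borel G] u)
  (mf : measurable_fun [set: borel G] f).
Hypotheses (k0 : forall x, 0 <= k x) (u0 : forall x, 0 <= u x)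
  (f0 : forall x, 0 <= f x).
Variables (S0 S K C : set G).
Hypotheses (cS0 : compact S0) (cS : compact S) (cK : compact K).
Hypotheses (kS0 : forall x, k x != 0 -> S0 x)
  (fK : forall x : G, f (x^-1)%g != 0 -> K x)
  (KC : forall z x, K x -> C (z * x * z^-1)%g)
  (CS : forall c s, C c -> S0 (c * s)%g -> S s).
Variables (e : R) (s : seq G) (J : borel G -> nat).
Hypotheses (e0 : 0 <= e)
  (mJ : forall j, measurable [set x | J x = j])
  (sC : forall j, (j < size s)%N -> C (nth 1%g s j))
  (JC : forall x, C x -> (J x < size s)%N /\
    forall t, k (nth 1%g s (J x) * t)%g <= k (x * t)%g + e).
Local Open Scope ereal_scope.

Let fV (x : borel G) : \bar R := (f ((x^-1)%g : borel G))%:E.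
Let D j (x : borel G) : \bar R := (\1_[set x | J x = j] x)%:E.

Let invg_borel : measurable_fun [set: borel G] ((fun x => x^-1%g) : borel G -> borel G).
Proof. by apply: continuous_borel; exact: invg_continuous. Qed.

Let mfV : measurable_fun [set: borel G] fV.
Proof. by apply/measurable_EFinP; exact: (measurableT_comp mf invg_borel). Qed.

Let fV0 x : 0 <= fV x. Proof. by rewrite lee_fin. Qed.

Let mD j : measurable_fun [set: borel G] (D j).
Proof. by apply/measurable_EFinP; exact: measurable_indic. Qed.

Let mconj z : measurable_fun [set: borel G] ((fun x => z * x * z^-1)%g : borel G -> borel G).
Proof. by apply: continuous_borel; exact: continuous_conjg. Qed.

Let cv (h : borel G -> \bar R) (z : G) : \bar R :=
  \int[mu]_t (h t * (u ((t^-1 * z)%g : borel G))%:E).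

Let muV z : measurable_fun [set: borel G] (fun t : borel G => (u ((t^-1 * z)%g : borel G))%:E).
Proof.
apply/measurable_EFinP; apply: (measurableT_comp mu_).
exact: (measurable_pairl z (@measurable_divl G)).
Qed.

Let mkt c : measurable_fun [set: borel G] (fun t : borel G => (k ((c * t)%g : borel G))%:E).
Proof. by apply/measurable_EFinP; apply: (measurableT_comp mk); exact: mulgl_borel. Qed.

(** The weight [q_j] of the overview, still extended-valued. *)
Definition conjg_weight j (z : G) : \bar R :=
  \int[mu]_x (fV x * D j ((z * x * z^-1)%g : borel G)).

(** The integrand of [(k * u * f) z] after the substitution [y := t^-1 z x], with [p = (t, x)]. It
    vanishes unless [t] lies in [S0] and [x] in [K], both compact, which allows the exchange of
    integrals. *)
Let F z (p : G * G) : \bar R :=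
  (k p.1)%:E * ((u ((p.1^-1 * (z * p.2))%g : borel G))%:E * fV p.2).

Let mF z : measurable_fun [set: borelT (G * G)%type] (F z).
Proof.
have m1 : measurable_fun [set: borelT (G * G)%type] ((fun p => p.1) : borelT (G * G)%type -> borel G).
  by apply: (@continuous_borel (G * G)%type G) => p; exact: cvg_fst.
have m2 : measurable_fun [set: borelT (G * G)%type] ((fun p => p.2) : borelT (G * G)%type -> borel G).
  by apply: (@continuous_borel (G * G)%type G) => p; exact: cvg_snd.
apply: emeasurable_funM.
  by apply/measurable_EFinP; exact: (measurableT_comp mk m1).
apply: emeasurable_funM; last exact: (measurableT_comp mfV m2).
apply/measurable_EFinP; apply: (measurableT_comp mu_).
apply: (@continuous_borel (G * G)%type G); apply: continuousMg.
  by apply: continuousVg => p; exact: cvg_fst.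
apply: continuousMg; last by move=> p; exact: cvg_snd.
by move=> p; exact: cst_continuous.
Qed.

Let F0 z p : 0 <= F z p. Proof. by rewrite mule_ge0 ?mule_ge0 ?lee_fin. Qed.

Let F_supp z t x : F z (t, x) != 0 -> S0 t /\ K x.
Proof.
move=> Ftx; split.
  by apply: kS0; apply: contraNneq Ftx => /= kt; rewrite /F /= kt mul0e.
by apply: fK; apply: contraNneq Ftx => /= fx; rewrite /F /fV /= fx !mule0.
Qed.

Let conv_conv z :
  \int[mu]_t ((k t)%:E * \int[mu]_y ((u y)%:E * (f ((y^-1 * (t^-1 * z))%g : borel G))%:E)) =
  \int[mu]_x \int[mu]_t F z (t, x).
Proof.
rewrite -(haar_tonelli hG haar (F0 z) (mF z) (compact_sigma_bounded cS0)
  (compact_sigma_bounded cK) (F_supp (z := z))).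
apply: eq_integral => t _.
rewrite -(haar_integral haar (t^-1 * z)%g); last 2 first.
- apply: emeasurable_funM; first exact/measurable_EFinP.
  apply/measurable_EFinP; apply: (measurableT_comp mf).
  exact: (measurable_pairl (t^-1 * z)%g (@measurable_divl G)).
- by move=> y; rewrite mule_ge0 ?lee_fin.
rewrite -ge0_integralZl//; last 3 first.
- apply: emeasurable_funM => //.
  + apply/measurable_EFinP; apply: (measurableT_comp mu_); exact: mulgl_borel.
  + apply/measurable_EFinP; apply: (measurableT_comp mf).
    apply: (@measurableT_comp _ _ _ _ _ _ (fun y : borel G => (y^-1 * (t^-1 * z))%g : borel G)).
      exact: (measurable_pairl (t^-1 * z)%g (@measurable_divl G)).
    exact: mulgl_borel.
- by move=> y _; rewrite mule_ge0 ?lee_fin.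
- by rewrite lee_fin.
apply: eq_integral => y _; rewrite /F /fV /= !mulgA; congr (_ * (_ * (f _)%:E)).
by rewrite !invgM !mulgA !mulgVK.
Qed.

(** Replacing [t] by [(z x z^-1) t] turns the right translation of [u] by [x] into a left
    translation of [k] by a conjugate of [x]; this is where conjugacy classes enter. *)
Let F_conj z x : \int[mu]_t F z (t, x) =
  \int[mu]_t ((k ((z * x * z^-1 * t)%g : borel G))%:E *
    (u ((t^-1 * z)%g : borel G))%:E) * fV x.
Proof.
rewrite -(haar_integral haar (z * x * z^-1)%g); last 2 first.
- exact: (measurable_pairr x (mF z)).
- by move=> t.
rewrite -ge0_integralZr//; last 2 first.
- exact: emeasurable_funM.
- by move=> t _; rewrite mule_ge0 ?lee_fin.
apply: eq_integral => t _; rewrite /F /= muleA; congr ((k _)%:E * (u _)%:E * _).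
by rewrite !invgM invgK !mulgA !mulgVK.
Qed.

Let cv_ge0 (h : borel G -> R) z : (forall x, 0 <= h x)%R -> 0 <= cv (EFin \o h) z.
Proof. by move=> h0; apply: integral_ge0 => t _; rewrite mule_ge0 ?lee_fin ?h0. Qed.

Let mS : measurable (S : set (borel G)).
Proof. exact: compact_borel. Qed.

(** For fixed [x] only the piece containing the conjugate [c] of [x] contributes. There
    [k (c_j t) <= k (c t) + e], and since the left side vanishes for [t] outside [S], the error may
    be multiplied by the indicator of [S], which keeps it integrable. *)
Let pointwise z x :
  \sum_(j < size s) (fV x * D j ((z * x * z^-1)%g : borel G) *
    cv (fun t => (k ((nth 1%g s j * t)%g : borel G))%:E) z) <=
  \int[mu]_t F z (t, x) +
    fV x * (e%:E * cv (fun t => (\1_(S : set (borel G)) t)%:E) z).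
Proof.
have E0 : 0 <= cv (fun t => (\1_(S : set (borel G)) t)%:E) z by exact: cv_ge0.
have [fx0|fx] := eqVneq (fV x) 0.
  rewrite big1 => [|j _]; last by rewrite fx0 !mul0e.
  by rewrite fx0 mul0e adde0 integral_ge0.
have Cc : C (z * x * z^-1)%g.
  by apply: KC; apply: fK; apply: contraNneq fx => fx; rewrite /fV fx.
have [js kc] := JC Cc; set c := (z * x * z^-1)%g in Cc js kc *.
rewrite (bigD1 (Ordinal js))//= big1 => [|j jJ]; last first.
  rewrite /D indicE memNset ?mule0 ?mul0e// => /= Jj.
  by move/eqP: jJ; apply; apply/val_inj => /=; rewrite -Jj.
rewrite adde0 /D indicE mem_set// mule1 F_conj -/c.
rewrite [X in _ <= X + _]muleC -ge0_muleDr//; last 2 first.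
- by apply: integral_ge0 => t _; rewrite mule_ge0 ?lee_fin.
- by rewrite mule_ge0 ?lee_fin.
apply: lee_wpmul2l => //; rewrite /cv.
rewrite -ge0_integralZl//; last 2 first.
- by apply: emeasurable_funM => //; apply/measurable_EFinP; exact: measurable_indic.
- by move=> t _; rewrite mule_ge0 ?lee_fin.
rewrite -ge0_integralD//; last 4 first.
- by move=> t _; rewrite mule_ge0 ?lee_fin.
- exact: emeasurable_funM.
- by move=> t _; rewrite mule_ge0 ?mule_ge0 ?lee_fin.
- apply: measurable_funeM; apply: emeasurable_funM => //.
  by apply/measurable_EFinP; exact: measurable_indic.
apply: ge0_le_integral => //.
- by move=> t _; rewrite mule_ge0 ?lee_fin.
- exact: emeasurable_funM.
- apply: emeasurable_funD; first exact: emeasurable_funM.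
  apply: measurable_funeM; apply: emeasurable_funM => //.
  by apply/measurable_EFinP; exact: measurable_indic.
move=> t _; rewrite -!EFinM -EFinD lee_fin mulrA -mulrDl ler_wpM2r//.
have [->|kt] := eqVneq (k (nth 1%g s (J c) * t)%g) 0%R.
  by rewrite addr_ge0 ?mulr_ge0.
rewrite indicE mem_set ?mulr1//.
by apply: (CS (c := nth 1%g s (J c))); [exact: sC|exact: kS0].
Qed.

Lemma convolution_lower z :
  \sum_(j < size s) (conjg_weight j z *
    \int[mu]_t ((k ((nth 1%g s j * t)%g : borel G))%:E *
      (u ((t^-1 * z)%g : borel G))%:E)) <=
  \int[mu]_t ((k t)%:E *
    \int[mu]_y ((u y)%:E * (f ((y^-1 * (t^-1 * z))%g : borel G))%:E)) +
  \int[mu]_x fV x * (e%:E * \int[mu]_t ((\1_(S : set (borel G)) t)%:E *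
    (u ((t^-1 * z)%g : borel G))%:E)).
Proof.
have mfD j : measurable_fun [set: borel G]
    (fun x : borel G => fV x * D j ((z * x * z^-1)%g : borel G)).
  by apply: emeasurable_funM => //; exact: (measurableT_comp (mD j) (mconj z)).
have D0 j x : 0 <= D j x by rewrite lee_fin.
rewrite conv_conv.
rewrite -[X in _ <= _ + X]ge0_integralZr//; last first.
  by rewrite mule_ge0 ?lee_fin//; apply: integral_ge0 => t _; rewrite mule_ge0 ?lee_fin.
have mIF : measurable_fun [set: borel G] (fun x : borel G => \int[mu]_t F z (t, x)).
  apply: (@measurable_haar_tonelli _ _ _ hG haar (fun p => F z (p.2, p.1)) _ _ S0).
  - by move=> p.
  - apply: (measurableT_comp (mF z)).
    apply: (@continuous_borel (G * G)%type (G * G)%type).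
    exact: swap_continuous.
  - exact: compact_sigma_bounded.
  - by move=> x t /F_supp[].
rewrite -ge0_integralD//; last 3 first.
- by move=> x _; exact: integral_ge0.
- move=> x _; rewrite mule_ge0// mule_ge0 ?lee_fin//.
  by apply: integral_ge0 => t _; rewrite mule_ge0 ?lee_fin.
- exact: emeasurable_funM.
under eq_bigr => j _.
  rewrite -ge0_integralZr//; last 2 first.
  - by move=> x _; rewrite mule_ge0.
  - by apply: integral_ge0 => t _; rewrite mule_ge0 ?lee_fin.
  over.
rewrite -ge0_integral_sum//; last 2 first.
- by move=> j; exact: emeasurable_funM.
- move=> j x _; rewrite mule_ge0 ?mule_ge0//.
  by apply: integral_ge0 => t _; rewrite mule_ge0 ?lee_fin.
apply: ge0_le_integral => //.
- move=> x _; apply: sume_ge0 => j _; rewrite mule_ge0 ?mule_ge0//.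
  by apply: integral_ge0 => t _; rewrite mule_ge0 ?lee_fin.
- by apply: emeasurable_sum => j; exact: emeasurable_funM.
- by apply: emeasurable_funD => //; exact: emeasurable_funM.
Qed.

End convolution_lower.

(** * Bounded functions of compact support and their conjugation weights *)

Section compact_bounded.
Context {R : realType} {G : topologicalGroupType}.
Variable mu : {measure set (borel G) -> \bar R}.
Hypotheses (hG : hausdorff_space G) (lcG : locally_compact [set: G])
  (haar : left_haar_measure mu).

Local Notation integrable u := (mu.-integrable setT (EFin \o u)).

Lemma integrable_indic_lty (A : set (borel G)) : measurable A ->
  (mu A < +oo)%E -> integrable (\1_A : borel G -> R).
Proof.
move=> mA Aoo; apply/integrableP; split.
  by apply/measurable_EFinP; exact: measurable_indic.
under eq_integral do rewrite gee0_abs ?lee_fin//.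
by rewrite integral_indic// setIT.
Qed.

Definition compact_bounded (f : borel G -> R) :=
  [/\ measurable_fun [set: borel G] f, exists M, forall x, 0 <= f x <= M &
      exists2 K : set G, compact K & forall x, f x != 0 -> K x].

Lemma compact_bounded_integrable f : compact_bounded f -> integrable f.
Proof.
move=> [mf [M fM] [K cK fK]].
have mK : measurable (K : set (borel G)) by exact: compact_borel.
have iK : integrable (\1_K : borel G -> R).
  by apply: integrable_indic_lty => //; exact: haar_compact.
apply: (le_integrable measurableT _ _ (integrableZl measurableT M iK)).
  exact/measurable_EFinP.
move=> x _; rewrite /= lee_fin; have /andP[f0 fxM] := fM x.
have [->|fx] := eqVneq (f x) 0; first by rewrite normr0.
rewrite indicE mem_set ?mulr1; last exact: fK.
by rewrite ger0_norm// (le_trans fxM)// ler_norm.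
Qed.

Lemma compact_bounded_inv f : compact_bounded f ->
  compact_bounded (fun x : borel G => f ((x^-1)%g : borel G)).
Proof.
move=> [mf [M fM] [K cK fK]]; split; last 2 first.
- by exists M => x; exact: fM.
- exists [set x^-1%g | x in K].
    by apply: compact_image => //; exact: invg_continuous.
  by move=> x /fK Kx; exists x^-1%g => //; rewrite invgK.
by apply: (measurableT_comp mf); apply: continuous_borel; exact: invg_continuous.
Qed.

Lemma fineK_integral f : integrable f ->
  (\int[mu]_x (f x)%:E = (\int[mu]_x f x)%:E)%E.
Proof.
by move=> i; rewrite /Rintegral fineK//; exact: (integrable_fin_num measurableT i).
Qed.

(** Associativity at every [z], not only almost everywhere: boundedness of [f] makes the outer
    integral finite, and the null set where [k * u] is infinite does not affect it. *)
Lemma real_convolution_assoc (k u f : borel G -> R) z :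
  integrable k -> integrable u -> compact_bounded f ->
  (forall x, 0 <= k x) -> (forall x, 0 <= u x) ->
  (exists2 S : set G, compact S & forall x, k x != 0 -> S x) ->
  ((real_convolution mu (real_convolution mu k u) f z)%:E =
  \int[mu]_t ((k t)%:E *
    \int[mu]_y ((u y)%:E * (f ((y^-1 * (t^-1 * z))%g : borel G))%:E)))%E.
Proof.
move=> ik iu cf k0 u0 [S cS kS].
have [mf [M fM] [K cK fK]] := cf.
have f0 x : 0 <= f x by have /andP[] := fM x.
have M0 : 0 <= M by have /andP[h1 h2] := fM (1%g : G); exact: le_trans h2.
have mE (w : borel G -> R) : integrable w -> measurable_fun [set: borel G] w.
  by move=> iw; apply/measurable_EFinP; exact: measurable_int iw.
have [iw w0 _ _ aew] := real_convolutionP hG lcG haar ik iu k0 u0.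
set w := real_convolution mu k u in iw w0 aew *.
pose fz (y : borel G) : \bar R := (f ((y^-1 * z)%g : borel G))%:E.
have mfz : measurable_fun [set: borel G] fz.
  apply/measurable_EFinP; apply: (measurableT_comp mf).
  exact: (measurable_pairl z (@measurable_divl G)).
have fz0 y : (0 <= fz y)%E by rewrite lee_fin.
pose F (p : G * G) : \bar R :=
  ((k p.2)%:E * (u ((p.2^-1 * p.1)%g : borel G))%:E * fz p.1)%E.
have mF : measurable_fun [set: borelT (G * G)%type] F.
  have m1 : measurable_fun [set: borelT (G * G)%type] ((fun p => p.1) : borelT (G * G)%type -> borel G).
    by apply: (@continuous_borel (G * G)%type G) => p; exact: cvg_fst.
  apply: emeasurable_funM; last exact: (measurableT_comp mfz m1).
  apply: emeasurable_funM.
    by apply/measurable_EFinP; exact: (measurableT_comp (mE _ ik) (@measurable_sndG G)).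
  by apply/measurable_EFinP; exact: (measurableT_comp (mE _ iu) (@measurable_divl G)).
have F0 p : (0 <= F p)%E by rewrite mule_ge0 ?mule_ge0 ?lee_fin.
have cKz : compact [set (z * x^-1)%g | x in K].
  apply: compact_image => //.
  apply: (@continuousMg _ _ (fun=> z) (fun x => x^-1%g)); last exact: invg_continuous.
  by move=> x; exact: cst_continuous.
have F_supp y t : F (y, t) != 0%E -> [set (z * x^-1)%g | x in K] y /\ S t.
  move=> Fyt; split; last first.
    by apply: kS; apply: contraNneq Fyt => kt; rewrite /F /= kt !mul0e.
  exists (y^-1 * z)%g; last by rewrite invgM invgK mulVKg.
  by apply: fK; apply: contraNneq Fyt => fy; rewrite /F /fz /= fy mule0.
have muz t y : measurable_fun [set: borel G] (fun x : borel G => (u x * f ((x^-1 * y)%g : borel G))%:E).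
  apply/measurable_EFinP; apply: measurable_funM; first exact: mE.
  by apply: (measurableT_comp mf); exact: (measurable_pairl y (@measurable_divl G)).
have mwE : measurable_fun [set: borel G] (fun y : borel G => (w y)%:E).
  exact: measurable_int iw.
transitivity (\int[mu]_y ((w y)%:E * fz y))%E.
  rewrite /real_convolution fineK// ge0_fin_numE; last first.
    by apply: integral_ge0 => y _; rewrite mule_ge0 ?lee_fin.
  apply: (@le_lt_trans _ _ (\int[mu]_y ((w y)%:E * M%:E)))%E; last first.
    rewrite ge0_integralZr//; last by move=> y _; rewrite lee_fin.
    by rewrite [X in (X * _)%E]fineK_integral// -EFinM ltry.
  apply: ge0_le_integral => //.
  - by move=> y _; rewrite mule_ge0 ?lee_fin.
  - exact: emeasurable_funM.
  - exact: emeasurable_funM.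
  - move=> y _; rewrite lee_wpmul2l ?lee_fin//.
    by have /andP[] := fM (y^-1 * z)%g.
transitivity (\int[mu]_y \int[mu]_t F (y, t))%E.
  transitivity (\int[mu]_y ((\int[mu]_t ((k t)%:E * (u ((t^-1 * y)%g : borel G))%:E)) * fz y))%E.
    apply: ge0_ae_eq_integral => //.
    - exact: emeasurable_funM.
    - apply: emeasurable_funM => //.
      apply: (measurable_ge0_convolution hG haar (u := EFin \o k) (v := EFin \o u)).
      + by apply/measurable_EFinP; exact: mE.
      + by apply/measurable_EFinP; exact: mE.
      + by move=> x; rewrite lee_fin.
      + by move=> x; rewrite lee_fin.
      + exact: (integrable_sigma_bounded hG lcG haar ik).
    - by move=> y _; rewrite mule_ge0 ?lee_fin.
    - move=> y _; rewrite mule_ge0//; apply: integral_ge0 => t _.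
      by rewrite mule_ge0 ?lee_fin.
    - by apply: filterS aew => y -> _.
  apply: eq_integral => y _; rewrite -ge0_integralZr//.
  - apply: emeasurable_funM; first by apply/measurable_EFinP; exact: mE.
    apply/measurable_EFinP; apply: (measurableT_comp (mE _ iu)).
    exact: (measurable_pairl y (@measurable_divl G)).
  - by move=> t _; rewrite mule_ge0 ?lee_fin.
rewrite (haar_tonelli hG haar F0 mF (compact_sigma_bounded cKz)
  (compact_sigma_bounded cS) F_supp).
apply: eq_integral => t _.
rewrite -(haar_integral haar t); last 2 first.
- exact: (measurable_pairr t mF).
- by move=> y.
rewrite -ge0_integralZl//; last 3 first.
- by under eq_fun do rewrite -EFinM; exact: muz.
- by move=> y _; rewrite mule_ge0 ?lee_fin.
- by rewrite lee_fin.
by apply: eq_integral => y _; rewrite /F /fz /= muleA mulKg invgM mulgA.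
Qed.

Section conjg_weight.
Variables (f : borel G -> R) (J : borel G -> nat).
Hypotheses (cf : compact_bounded f)
  (mJ : forall j, measurable [set x | J x = j]).

Let fV (x : borel G) : \bar R := (f ((x^-1)%g : borel G))%:E.
Let D j (x : borel G) : \bar R := (\1_[set x | J x = j] x)%:E.

Let mfV : measurable_fun [set: borel G] fV.
Proof. by apply/measurable_EFinP; have [? _ _] := compact_bounded_inv cf. Qed.

Let fV0 x : (0 <= fV x)%E.
Proof. by have [_ [M fM] _] := cf; have /andP[f0 _] := fM (x^-1)%g; rewrite lee_fin. Qed.

Let D0 j x : (0 <= D j x)%E. Proof. by rewrite lee_fin. Qed.

Let mfD j z : measurable_fun [set: borel G]
  (fun x : borel G => fV x * D j ((z * x * z^-1)%g : borel G))%E.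
Proof.
apply: emeasurable_funM => //.
have mD : measurable_fun [set: borel G] (D j).
  by apply/measurable_EFinP; exact: measurable_indic.
apply: (measurableT_comp mD); apply: continuous_borel; exact: continuous_conjg.
Qed.

Lemma conjg_weight_ge0 j z : (0 <= conjg_weight mu f J j z)%E.
Proof.
by apply: integral_ge0 => x _; apply: mule_ge0; [exact: fV0|exact: D0].
Qed.

Lemma conjg_weight_le j z : (conjg_weight mu f J j z <= \int[mu]_x fV x)%E.
Proof.
apply: ge0_le_integral => //.
- by move=> x _; apply: mule_ge0; [exact: fV0|exact: D0].
- exact: mfD.
- move=> x _; rewrite -[leRHS]mule1; apply: lee_wpmul2l; first exact: fV0.
  by rewrite lee_fin indicE lern1 leq_b1.
Qed.

Lemma measurable_conjg_weight j :
  measurable_fun [set: borel G] (conjg_weight mu f J j).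
Proof.
have [_ _ [K cK fK]] := compact_bounded_inv cf.
apply: (@measurable_haar_tonelli _ _ _ hG haar
  (fun p => fV p.2 * D j ((p.1 * p.2 * p.1^-1)%g : borel G))%E _ _ K).
- by move=> p; rewrite mule_ge0.
- apply: emeasurable_funM; first exact: (measurableT_comp mfV (@measurable_sndG G)).
  have mD : measurable_fun [set: borel G] (D j).
    by apply/measurable_EFinP; exact: measurable_indic.
  apply: (measurableT_comp mD).
  apply: (@continuous_borel (G * G)%type G); apply: continuousMg.
    by apply: continuousMg => p; [exact: cvg_fst|exact: cvg_snd].
  by apply: continuousVg => p; exact: cvg_fst.
- exact: compact_sigma_bounded.
- by move=> z x /=; move=> h; apply: fK; apply: contraNneq h => h; rewrite /fV h mul0e.
Qed.

Lemma sum_conjg_weight n z :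
  (forall x : G, f (x^-1)%g != 0 -> (J (z * x * z^-1)%g < n)%N) ->
  (\sum_(j < n) conjg_weight mu f J j z = \int[mu]_x fV x)%E.
Proof.
move=> Jn; rewrite -ge0_integral_sum//; last 2 first.
- by move=> j; exact: mfD.
- by move=> j x _; apply: mule_ge0; [exact: fV0|exact: D0].
apply: eq_integral => x _; have [fx|/Jn Jx] := eqVneq (f (x^-1)%g) 0.
  by rewrite /fV fx big1// => j _; rewrite mul0e.
rewrite (bigD1 (Ordinal Jx))//= big1 => [|j jJ]; last first.
  rewrite /D indicE memNset ?mule0// => /= Jj.
  by move/eqP: jJ; apply; apply/val_inj => /=; rewrite -Jj.
by rewrite adde0 /D indicE mem_set// mule1.
Qed.

End conjg_weight.

Lemma haar_integrable (k : borel G -> R) c : integrable k -> (forall x, 0 <= k x) ->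
  integrable (fun t : borel G => k ((c * t)%g : borel G)) /\
  \int[mu]_t k ((c * t)%g : borel G) = \int[mu]_t k t.
Proof.
move=> ik k0; have mk : measurable_fun [set: borel G] (EFin \o k).
  exact: measurable_int ik.
have e : (\int[mu]_t (k ((c * t)%g : borel G))%:E = \int[mu]_t (k t)%:E)%E.
  by apply: (haar_integral haar c mk) => x; rewrite lee_fin.
split; last by rewrite /Rintegral e.
apply/integrableP; split; first by apply: (measurableT_comp mk); exact: mulgl_borel.
under eq_integral do rewrite gee0_abs ?lee_fin//.
by rewrite e fineK_integral// ltry.
Qed.

End compact_bounded.

(** * The lower bound for the mean of [T f] *)

Section mean_lower.
Context {R : realType} {G : topologicalGroupType}.
Variable mu : {measure set (borel G) -> \bar R}.
Hypotheses (hG : hausdorff_space G) (lcG : locally_compact [set: G])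
  (haar : left_haar_measure mu) (fcG : FC_closure G).
Variable m : {scalar Linfty mu}.
Hypotheses (mm : is_mean m) (tli : top_left_invariant m).
Implicit Types (T : Linfty mu).

Local Notation integrable u := (mu.-integrable setT (EFin \o u)).

Section domination.
Variables (k f oneS : borel G -> R) (q : nat -> borel G -> R)
  (h : nat -> borel G -> R) (M a e : R) (n : nat).
Hypotheses (ik : integrable k) (k0 : forall x, 0 <= k x)
  (iff : integrable f) (f0 : forall x, 0 <= f x)
  (ioneS : integrable oneS) (oneS0 : forall x, 0 <= oneS x)
  (ih : forall j, integrable (h j)) (h0 : forall j x, 0 <= h j x)
  (mq : forall j, measurable_fun [set: borel G] (q j))
  (qM : forall j x, `|q j x| <= M).

(** Evaluated at [u], the functional is [T] applied to a single element [X] of [L1], and the assumed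
    inequality says that [X] is nonnegative almost everywhere. *)
Lemma nonneg_domination T : nonneg_Linfty T ->
  (forall u, integrable u -> (forall x, 0 <= u x) -> {ae mu, forall z : borel G,
    \sum_(j < n) q j z * real_convolution mu (h j) u z <=
    real_convolution mu (real_convolution mu k u) f z +
    a * real_convolution mu oneS u z}) ->
  nonneg_Linfty (lmodule_act (realL1 mu k) (rmodule_act T (realL1 mu f)) +
    a%:C *: lmodule_act (realL1 mu oneS) T -
    \sum_(j < n) lmodule_act (realL1 mu (h j)) (mul_Linfty (q j) T)).
Proof.
move=> T0 dom; apply: nonneg_LinftyP => u iu u0.
have rM (x y : R) : (x * y)%:C = x%:C * y%:C :> R[i] by exact: rmorphM.
have [iw w0 ew _ _] := real_convolutionP hG lcG haar ik iu k0 u0.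
have [iA _ eA _ _] := real_convolutionP hG lcG haar iw iff w0 f0.
have [iE _ eE _ _] := real_convolutionP hG lcG haar ioneS iu oneS0 u0.
have vP j := real_convolutionP hG lcG haar (ih j) iu (h0 j) u0.
pose A := real_convolution mu (real_convolution mu k u) f.
pose B := real_convolution mu oneS u.
pose v j := real_convolution mu (h j) u.
have iv j : integrable (v j) by have [] := vP j.
pose X : L1 mu := realL1 mu A + a%:C *: realL1 mu B -
  \sum_(j < n) mulL1 (q j) (realL1 mu (v j)).
suff -> : (lmodule_act (realL1 mu k) (rmodule_act T (realL1 mu f)) +
    a%:C *: lmodule_act (realL1 mu oneS) T -
    \sum_(j < n) lmodule_act (realL1 mu (h j)) (mul_Linfty (q j) T)) (realL1 mu u) = T X.
  apply: T0; apply: filterS (dom u iu u0) => z Hz.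
  have -> : X z = (A z + a * B z - \sum_(j < n) q j z * v j z)%:C.
    rewrite -[LHS]/(realL1 mu A z + a%:C * realL1 mu B z -
      L1_fun (\sum_(j < n) mulL1 (q j) (realL1 mu (v j))) z) L1_sum.
    under eq_bigr => j _ do rewrite (mulL1E (mq j) (qM j)) realL1E// -rM.
    rewrite !realL1E// -rM -(raddf_sum (real_complex R)).
    by rewrite -[RHS]/(real_complex R _) rmorphB rmorphD.
  by rewrite ler0c subr_ge0.
rewrite /X LinftyB LinftyD LinftyZ Linfty_sum.
rewrite -[LHS]/(lmodule_act (realL1 mu k) (rmodule_act T (realL1 mu f)) (realL1 mu u) +
  a%:C * lmodule_act (realL1 mu oneS) T (realL1 mu u) -
  (\sum_(j < n) lmodule_act (realL1 mu (h j)) (mul_Linfty (q j) T)) (realL1 mu u)).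
congr (_ + a%:C * _ - _).
- by rewrite (lmodule_actE hG lcG haar) (rmodule_actE hG lcG haar) ew eA.
- by rewrite (lmodule_actE hG lcG haar) eE.
- rewrite Linfty_sumE; apply: eq_bigr => j _.
  rewrite (lmodule_actE hG lcG haar) (mul_LinftyE (mq j) (qM j)).
  by have [_ _ -> _ _] := vP j.
Qed.

End domination.

(* Pointwise, the convolution inequality says
   [sum_j h_j (q_j T) <= k (T f) + e I (1_S T)] as functionals, where [h_j] is a
   left translate of [k], so that left invariance of [m] applies to each term. *)
Lemma mean_lower_approx T f : nonneg_Linfty T -> compact_bounded f ->
  exists a b : R, 0 < a /\ forall e, 0 < e ->
    (a * \int[mu]_x f ((x^-1)%g : borel G))%:C * m T <=
    a%:C * m (rmodule_act T (realL1 mu f)) + (e * b)%:C * m T.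
Proof.
move=> T0 cf; have [mf [M fM] _] := cf.
have f0 x : 0 <= f x by have /andP[] := fM x.
have iff := compact_bounded_integrable hG haar cf.
have cfV := compact_bounded_inv cf.
have ifV := compact_bounded_integrable hG haar cfV.
have [_ _ [K cK fK]] := cfV.
have [k [ik [Mk kM] Ik0 [S0 cS0 kS0] kunif]] := exists_smoothing_kernel hG lcG haar.
have k0 x : 0 <= k x by have /andP[] := kM x.
have mk : measurable_fun [set: borel G] k.
  by apply/measurable_EFinP; exact: measurable_int ik.
have [C cC CP] := conjg_bounded hG lcG fcG cK.
have [V cV nV] := nbhs1_compact hG lcG.
(* The first part contains the supports of all translates [t |-> k (c t)] with [c] in [C]; adding
   [V] makes the measure of [S] positive, so that left invariance applies to its indicator. *)
pose S := [set (x * y)%g | x in [set x^-1%g | x in C] & y in S0] `|` V.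
have cS : compact S.
  apply: compactU => //; apply: compact_mulg => //.
  by apply: compact_image => //; exact: invg_continuous.
have CS c t : C c -> S0 (c * t)%g -> S t.
  move=> Cc S0t; left; exists c^-1%g; first by exists c.
  by exists (c * t)%g => //; rewrite mulKg.
have mS : measurable (S : set (borel G)) by exact: compact_borel.
pose oneS : borel G -> R := \1_(S : set (borel G)).
have ioneS : integrable oneS by apply: integrable_indic_lty => //; exact: haar_compact.
have oneS0 x : 0 <= oneS x by [].
have IS0 : 0 < \int[mu]_x oneS x.
  rewrite -lte_fin -fineK_integral// integral_indic// setIT.
  apply: (@lt_le_trans _ _ (mu (V° : set G))).
    apply: (haar_open_gt0 hG haar); first exact: open_interior.
    by exists 1%g.
  apply: le_measure; rewrite ?inE//; first by apply: open_borel; exact: open_interior.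
  by move=> x /interior_subset Vx; right.
set I := \int[mu]_x f ((x^-1)%g : borel G).
have I0 : 0 <= I by apply: Rintegral_ge0 => x _; exact: f0.
(* Both constants are fixed before [e], hence before the partition, whose size is therefore
   immaterial. *)
exists (\int[mu]_x k x), (I * \int[mu]_x oneS x); split => // e e0.
have [W nW kW] := kunif e e0.
have [s [J [mJ sC JC]]] := compact_partition cC nW.
have {}JC x : C x -> (J x < size s)%N /\
    forall t, k (nth 1%g s (J x) * t)%g <= k (x * t)%g + e.
  move=> /JC[Js Wx]; split => // t.
  by have := kW _ (x * t)%g Wx; rewrite mulgA mulgVK.
pose h j (t : borel G) := k ((nth 1%g s j * t)%g : borel G).
have hP j := haar_integrable haar (nth 1%g s j) ik k0.
have ih j : integrable (h j) by have [] := hP j.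
have h0 j x : 0 <= h j x by exact: k0.
have Ih j : \int[mu]_x h j x = \int[mu]_x k x by have [] := hP j.
pose q j (z : borel G) := fine (conjg_weight mu f J j z).
have IfV : (\int[mu]_x (f ((x^-1)%g : borel G))%:E = I%:E)%E by exact: fineK_integral.
have wfin j z : conjg_weight mu f J j z \is a fin_num.
  rewrite ge0_fin_numE; last exact: conjg_weight_ge0.
  by rewrite (le_lt_trans (conjg_weight_le mu cf mJ j z))// IfV ltry.
have q0 j z : 0 <= q j z by apply: fine_ge0; exact: conjg_weight_ge0.
have qI j z : `|q j z| <= I.
  rewrite ger0_norm// -lee_fin fineK// -IfV; exact: conjg_weight_le.
have mq j : measurable_fun [set: borel G] (q j).
  apply: (measurableT_comp (fine_measurable (D := setT) measurableT)).
  exact: measurable_conjg_weight.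
have sumq z : \sum_(j < size s) q j z = I.
  apply: EFin_inj; rewrite -sumEFin -IfV -(@sum_conjg_weight _ _ mu f J cf mJ (size s) z).
    by apply: eq_bigr => j _; rewrite fineK.
  by move=> x /fK /(CP z)/JC[].
pose L := lmodule_act (realL1 mu k) (rmodule_act T (realL1 mu f)).
pose E := lmodule_act (realL1 mu oneS) T.
pose Q (j : 'I_(size s)) := lmodule_act (realL1 mu (h j)) (mul_Linfty (q j) T).
have key : nonneg_Linfty (L + (e * I)%:C *: E - \sum_j Q j).
  apply: (nonneg_domination ik k0 iff f0 ioneS oneS0 ih h0 mq qI T0) => u iu u0.
  have mu_ : measurable_fun [set: borel G] u.
    by apply/measurable_EFinP; exact: measurable_int iu.
  have [_ _ _ _ aeE] := real_convolutionP hG lcG haar ioneS iu oneS0 u0.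
  apply: filterS aeE => z Ez.
  have := convolution_lower hG haar mk mu_ mf k0 u0 f0 cS0 cS cK kS0 fK
    (fun z x Kx => CP z x Kx) CS (ltW e0) mJ sC JC z.
  rewrite -(real_convolution_assoc hG lcG haar z ik iu cf k0 u0 (ex_intro2 _ _ S0 cS0 kS0)).
  rewrite -Ez IfV -!EFinM -EFinD => lower.
  rewrite -lee_fin; apply: le_trans (le_trans lower _); last first.
    by rewrite lee_fin mulrA [I * e]mulrC.
  rewrite -sumEFin; apply: lee_sum => j _; rewrite EFinM /q fineK//.
  apply: lee_wpmul2l; first exact: conjg_weight_ge0.
  (* On this side [fine v <= v] is enough, even where [v] is infinite; the equality at [z] is needed
     only for the error term. *)
  rewrite /real_convolution; set v := integral _ _ _.
  have : (0 <= v)%E by apply: integral_ge0 => t _; rewrite mule_ge0 ?lee_fin ?u0 ?h0.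
  by case: v => [r| |] //= _; rewrite leey.
have := mm.1 _ key.
rewrite meanB meanD meanZ subr_ge0.
have -> : m (\sum_j Q j) = (\int[mu]_x k x)%:C * (I%:C * m T).
  rewrite linear_sum /=.
  under eq_bigr => j _.
    rewrite (tli_realL1 hG lcG haar _ tli (ih j) (h0 j)) ?Ih//; over.
  rewrite -mulr_sumr -linear_sum /= -[I%:C * m T]meanZ.
  congr (_ * m _).
  apply: Linfty_eqP => g; rewrite Linfty_sumE.
  under eq_bigr => j _ do rewrite (mul_LinftyE (mq j) (qI j)).
  rewrite -Linfty_sum -[RHS]/(I%:C * T g) -LinftyZ; congr (T _).
  apply/val_inj/funext => x; rewrite -[LHS]/(L1_fun (\sum_(j < size s) mulL1 (q j) g) x) L1_sum.
  under eq_bigr => j _ do rewrite (mulL1E (mq j) (qI j)).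
  have rS : \sum_(j < size s) (q j x)%:C = (\sum_(j < size s) q j x)%:C :> R[i].
    by rewrite (raddf_sum (real_complex R)).
  by rewrite -mulr_suml rS sumq.
rewrite /L /E (tli_realL1 hG lcG haar _ tli ik k0 Ik0).
rewrite (tli_realL1 hG lcG haar _ tli ioneS oneS0 IS0).
have rM (x y : R) : (x * y)%:C = x%:C * y%:C :> R[i] by exact: rmorphM.
have aux (x y z w : R) (t t' : R[i]) : x%:C * (y%:C * t) <=
    x%:C * t' + (z * y)%:C * (w%:C * t) ->
    (x * y)%:C * t <= x%:C * t' + (z * (y * w))%:C * t.
  by rewrite !rM !mulrA.
exact: aux.
Qed.

End mean_lower.

(** Comparable elements of [R[i]] have equal imaginary parts, so [w] is real and the claim is a
    limit [e -> 0] in [R]. *)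
Lemma complex_le_approx (R : realType) (z w : R[i]) (a b c : R) :
  0 <= z -> 0 < a ->
  (forall e, 0 < e -> (a * c)%:C * z <= a%:C * w + (e * b)%:C * z) ->
  c%:C * z <= w.
Proof.
move: z w => [t t'] [w w']; rewrite lecE /= => /andP[/eqP t'0 t0] a0 H.
have w'0 : w' = 0.
  have := H 1 ltr01; rewrite lecE /= => /andP[/eqP + _].
  rewrite t'0 !mulr0 !mul0r !addr0 => h.
  by apply: (mulfI (lt0r_neq0 a0)); rewrite mulr0.
rewrite t'0 w'0 !mulr0 !mul0r addr0 eqxx /= subr0.
apply/ler_addgt0Pr => e e0.
pose p := `|b * t|.
have p1 : 0 < p + 1 by rewrite ltr_wpDl ?normr_ge0 ?ltr01.
(* The error parameter is [e * a / (|b t| + 1)], the [1] guarding against [b t = 0], so that the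
   error is at most [e] after division by [a]. *)
have := H _ (divr_gt0 (mulr_gt0 e0 a0) p1); rewrite lecE /= => /andP[_].
rewrite !mul0r !subr0 => h.
rewrite -(ler_pM2l a0) mulrA (le_trans h)// mulrDr lerD2l.
have -> : e * a / (p + 1) * b * t = a * e * ((p + 1)^-1 * (b * t)) by ring.
rewrite -[leRHS]mulr1 ler_wpM2l ?mulr_ge0 ?(ltW e0) ?(ltW a0)//.
by rewrite ler_pdivrMl// mulr1 (le_trans (ler_norm _))// lerDl.
Qed.

Lemma complex_le_cvg (R : realType) (z w : R[i]) (c : nat -> R) :
  0 <= z -> c @ \oo --> (1 : R) -> (forall n, (c n)%:C * z <= w) -> z <= w.
Proof.
move: z w => [t t'] [w w']; rewrite lecE /= => /andP[/eqP t'0 t0] c1 H.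
have := H 0%N; rewrite lecE /= t'0 !mulr0 !mul0r addr0 => /andP[/eqP w'0 _].
rewrite w'0 eqxx /=.
have ct : c n * t @[n --> \oo] --> t.
  by rewrite -[X in _ --> X]mul1r; exact: cvgMl.
rewrite -(cvg_lim (@Rhausdorff R) ct); apply: limr_le; first by apply/cvg_ex; exists t.
by near=> n; have := H n; rewrite lecE /= t'0 !(mulr0, mul0r) !subr0 => /andP[].
Unshelve. all: by end_near. Qed.

(** * From the lower bound to right invariance *)

Section right_invariance.
Context {R : realType} {G : topologicalGroupType}.
Variable mu : {measure set (borel G) -> \bar R}.
Hypotheses (hG : hausdorff_space G) (lcG : locally_compact [set: G])
  (haar : left_haar_measure mu) (fcG : FC_closure G).
Variable m : {scalar Linfty mu}.
Hypotheses (mm : is_mean m) (tli : top_left_invariant m).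
Implicit Types (T : Linfty mu).

Local Notation integrable u := (mu.-integrable setT (EFin \o u)).

Lemma nonneg_one_Linfty : nonneg_Linfty (one_Linfty mu).
Proof.
apply: nonneg_LinftyP => u iu u0.
rewrite -[X in 0 <= X]/(cintegral mu (realL1 mu u)) cintegral_realL1// ler0c.
by apply: Rintegral_ge0 => x _.
Qed.

Lemma mean_lower T f : nonneg_Linfty T -> compact_bounded f ->
  (\int[mu]_x f ((x^-1)%g : borel G))%:C * m T <=
  m (rmodule_act T (realL1 mu f)).
Proof.
move=> T0 cf; have mT0 : 0 <= m T by exact: mm.1.
have [a [b [a0 H]]] := mean_lower_approx hG lcG haar fcG mm tli T0 cf.
exact: (complex_le_approx mT0 a0 H).
Qed.

Lemma integral_inv_le f : compact_bounded f ->
  \int[mu]_x f ((x^-1)%g : borel G) <= \int[mu]_x f x.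
Proof.
move=> cf; have := mean_lower nonneg_one_Linfty cf.
have [_ [M fM] _] := cf.
have f0 x : 0 <= f x by have /andP[] := fM x.
rewrite (rmodule_act_one hG lcG haar) ?meanZ ?mm.2 ?mulr1 ?lecR//.
exact: (compact_bounded_integrable hG haar cf).
Qed.

Lemma mean_lower_integral T f : nonneg_Linfty T -> compact_bounded f ->
  (\int[mu]_x f x)%:C * m T <= m (rmodule_act T (realL1 mu f)).
Proof.
move=> T0 cf; apply: le_trans (mean_lower T0 cf).
apply: ler_wpM2r; first exact: mm.1.
rewrite lecR.
(* Applied to [x |-> f (x^-1)], the inequality between the two integrals is reversed, which is the
   direction wanted. *)
have := integral_inv_le (compact_bounded_inv cf).
by under eq_Rintegral do rewrite invgK.
Qed.

Lemma rmodule_act_le T f g : nonneg_Linfty T -> integrable f -> integrable g ->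
  (forall x, f x <= g x) ->
  nonneg_Linfty (rmodule_act T (realL1 mu g) - rmodule_act T (realL1 mu f)).
Proof.
move=> T0 iff ig fg; pose d x := g x - f x.
have id : integrable d.
  rewrite (_ : EFin \o d = (EFin \o g) \- (EFin \o f))%E; first exact: integrableB.
  by apply/funext => x.
have d0 x : 0 <= d x by rewrite subr_ge0.
have e : realL1 mu g = 1 *: realL1 mu d + realL1 mu f.
  apply/val_inj/funext => x; rewrite -[LHS]/(realL1 mu g x).
  rewrite -[RHS]/(1 * realL1 mu d x + realL1 mu f x) !realL1E// mul1r.
  by rewrite -rmorphD /= subrK.
apply: nonneg_LinftyP => u iu u0.
rewrite -[X in 0 <= X]/(rmodule_act T (realL1 mu g) (realL1 mu u) -
  rmodule_act T (realL1 mu f) (realL1 mu u)) !(rmodule_actE hG lcG haar) e.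
rewrite (Linfty_ae_eq T (ae_convolution_linearr hG lcG haar 1 _ _ _)).
rewrite Linfty_linear mul1r addrK.
have [ic c0 -> _ _] := real_convolutionP hG lcG haar iu id u0 d0.
by apply: T0; exact: nonneg_realL1.
Qed.

(** The support of [f] is covered by countably many compact sets; [f] is cut off to a finite union
    of them and to the set where [f <= n]. *)
Lemma compact_bounded_approx f : integrable f -> (forall x, 0 <= f x) ->
  exists g : nat -> borel G -> R, [/\ forall n, compact_bounded (g n),
    forall n x, g n x <= f x &
    \int[mu]_x g n x @[n --> \oo] --> \int[mu]_x f x].
Proof.
move=> iff f0.
have mf : measurable_fun [set: borel G] f by apply/measurable_EFinP; exact: measurable_int iff.
have [K cK fK] := integrable_sigma_bounded hG lcG haar iff.
pose L n := \big[setU/set0]_(i < n.+1) K i.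
have cL n : compact (L n) by apply: bigsetU_compact => i _.
pose A n : set (borel G) := L n `&` [set x | f x <= n%:R].
have mA n : measurable (A n).
  apply: measurableI; first exact: compact_borel.
  rewrite -[X in measurable X]setTI -preimage_itvNyc; exact: mf.
have ndA m' n : (m' <= n)%N -> A m' `<=` A n.
  move=> mn x [Lx fx]; split; last by rewrite /= (le_trans fx)// ler_nat.
  move: Lx; rewrite /L -!bigcup_mkord => -[i /= im Kx]; exists i => //=.
  exact: leq_trans mn.
pose g n x := f x * \1_(A n) x.
have g0 n x : 0 <= g n x by rewrite mulr_ge0.
have gf n x : g n x <= f x.
  by rewrite /g indicE ler_piMr// lern1 leq_b1.
have mg n : measurable_fun [set: borel G] (g n).
  by apply: measurable_funM => //; exact: measurable_indic.
exists g; split => // [n|].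
  split => //; first exists n%:R.
    move=> x; rewrite g0 /= /g indicE; case: (boolP (x \in A n)) => [/set_mem[]|_].
      by move=> _ /=; rewrite mulr1.
    by rewrite mulr0.
  exists (L n) => // x; rewrite /g indicE; case: (boolP (x \in A n)) => [/set_mem[]//|_].
  by rewrite mulr0 eqxx.
have cvgE : (\int[mu]_x (g n x)%:E)%E @[n --> \oo] --> (\int[mu]_x (f x)%:E)%E.
  rewrite (_ : (\int[mu]_x (f x)%:E)%E = (\int[mu]_x limn (fun n => (g n x)%:E))%E).
    apply: (@cvg_monotone_convergence _ _ _ mu setT measurableT).
    - by move=> n; apply/measurable_EFinP.
    - by move=> n x _; rewrite lee_fin.
    - move=> x _ m' n mn; rewrite lee_fin /g ler_wpM2l// !indicE.
      case: (boolP (x \in A m')) => [/set_mem/(ndA _ _ mn) An|_] //.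
      by rewrite mem_set.
  apply: eq_integral => x _; apply/esym/cvg_lim => //.
  have [fx|fx] := eqVneq (f x) 0.
    rewrite (_ : (fun _ => _) = cst (f x)%:E); first exact: cvg_cst.
    by apply/funext => n; rewrite /g fx mul0r.
  have [N _ KN] : (\bigcup_n K n) x by exact: fK.
  apply: cvg_near_cst; near=> n; rewrite /g indicE mem_set ?mulr1//; split.
    rewrite /L -bigcup_mkord; exists N => //=.
    by rewrite ltnS; near: n; exact: nbhs_infty_ge.
  rewrite /=; near: n; exact: nbhs_infty_ger.
apply: (fine_cvg (a := \int[mu]_x f x)).
by rewrite -fineK_integral.
Unshelve. all: by end_near. Qed.

Lemma rmodule_act_ae T (f g : L1 mu) : {ae mu, forall x : borel G, f x = g x} ->
  rmodule_act T f = rmodule_act T g.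
Proof.
move=> fg; apply: Linfty_eqP => h; rewrite !(rmodule_actE hG lcG haar).
have -> : f = 1 *: (f - g) + g by rewrite scale1r subrK.
rewrite (Linfty_ae_eq T (ae_convolution_linearr hG lcG haar 1 _ _ _)).
rewrite Linfty_linear mul1r -[RHS]add0r; congr (_ + _).
have n0 : norm1 (f - g) = 0.
  apply: norm1_ae_eq0; apply: filterS fg => x fgx.
  by rewrite -[LHS]/(f x - g x) fgx subrr.
have [_ [c Tc]] := LinftyP T.
have := norm1_convolution hG lcG haar h (f - g).
rewrite n0 !mulr0 => n1; have {}n1 : norm1 (convolution h (f - g)) = 0.
  by apply/eqP; rewrite eq_le n1 norm1_ge0.
by have := Tc (convolution h (f - g)); rewrite n1 mulr0 normr_le0 => /eqP.
Qed.

Lemma mean_right_nonneg T (f : L1 mu) : nonneg_Linfty T -> P1 f ->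
  m (rmodule_act T f) = m T.
Proof.
move=> T0 [/nonneg_L1_ae fE f1].
pose u (x : borel G) : R := complex.Re `|f x|.
have iu : integrable u by exact: integrable_Re_normr.
have u0 x : 0 <= u x by exact: Re_normr_ge0.
have Iu : \int[mu]_x u x = 1 by exact: f1.
have actE S : rmodule_act S f = rmodule_act S (realL1 mu u) by exact: rmodule_act_ae.
have [g [cg gu gI]] := compact_bounded_approx iu u0.
have lower S : nonneg_Linfty S -> m S <= m (rmodule_act S f).
  move=> S0; have mS0 : 0 <= m S by exact: mm.1.
  have H n : (\int[mu]_x g n x)%:C * m S <= m (rmodule_act S f).
    apply: le_trans (mean_lower_integral S0 (cg n)) _; rewrite actE.
    apply: (mean_le mm); apply: rmodule_act_le => //.
    exact: (compact_bounded_integrable hG haar (cg n)).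
  by rewrite Iu in gI; exact: (complex_le_cvg mS0 gI H).
(* Any norm bound for [T] serves as [c]. A density fixes the constant [1], so the lower bound for
   [c 1 - T] becomes an upper bound for [T]. *)
have [c Tc] : exists c : R, nonneg_Linfty (c%:C *: one_Linfty mu - T).
  have [_ [c Tc]] := LinftyP T; exists c; apply: nonneg_LinftyP => v iv v0.
  rewrite -[X in 0 <= X]/(c%:C * cintegral mu (realL1 mu v) - T (realL1 mu v)).
  rewrite cintegral_realL1// subr_ge0 -rmorphM /=.
  have := Tc (realL1 mu v); rewrite norm1_realL1// ger0_norm//.
  by apply: T0; exact: nonneg_realL1.
apply/eqP; rewrite eq_le (lower T T0) andbT.
have := lower _ Tc.
have -> : c%:C *: one_Linfty mu - T = (-1) *: T + c%:C *: one_Linfty mu.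
  by rewrite scaleN1r addrC.
rewrite (rmodule_act_linear hG lcG haar).
have -> : rmodule_act (c%:C *: one_Linfty mu) f = c%:C *: one_Linfty mu.
  have -> : c%:C *: one_Linfty mu = c%:C *: one_Linfty mu + 0 by rewrite addr0.
  have one1 : rmodule_act (one_Linfty mu) f = one_Linfty mu.
    by rewrite actE (rmodule_act_one hG lcG haar)// Iu; exact: scale1r.
  rewrite (rmodule_act_linear hG lcG haar) one1; congr (_ + _).
  by apply: Linfty_eqP => h; rewrite (rmodule_actE hG lcG haar).
by rewrite !meanD !meanZ lerD2r !mulN1r lerN2.
Qed.

Lemma mean_right_invariant : top_right_invariant m.
Proof.
move=> f T Pf; have [S1 [S2 [a [S10 S20 ->]]]] := Linfty_nonneg_decomp T.
have one0 := nonneg_one_Linfty.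
have -> : S1 + 'i *: S2 + a *: one_Linfty mu =
    a *: one_Linfty mu + ('i *: S2 + S1) by rewrite addrC [S1 + _]addrC.
rewrite !(rmodule_act_linear hG lcG haar).
by rewrite !meanD !meanZ !mean_right_nonneg.
Qed.

End right_invariance.

Theorem theorem5p7 (R : realType) (G : topologicalGroupType)
    (mu : {measure set (borel G) -> \bar R})
    (hG : hausdorff_space G) (lcG : locally_compact [set: G])
    (haar : left_haar_measure mu) (fcG : FC_closure G) :
  TLIM mu `<=` TIM mu.
Proof.
move=> m [mm tli]; split => //; exact: (mean_right_invariant hG lcG haar fcG mm tli).
Qed.
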